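(* For every odd prime $p$ and every integer $k\ge 1$, $$\mathrm{pq}(\mathbb{Z}_{p^k})=2p^k-p^{k-1}+\sum_{i=0}^{k-2}p^i,$$ and for every odd prime $p$, $$\mathrm{pq}(\mathbb{Z}_p^2)=4p^2-2.$$ Moreover, $\mathrm{pq}(\mathbb{Z}_{2^k})=2^{k+1}$ for every integer $k>2$, $\mathrm{pq}(\mathbb{Z}_4)=4$, $\mathrm{pq}(\mathbb{Z}_2)=1$ and $\mathrm{pq}(\mathbb{Z}_2^2)=7$.
   Context: A quasigroup is a set $A$ with a binary operation $*$ such that for all $a,b\in A$ the equations $a*x=b$ and $y*a=b$ have unique solutions $x,y\in A$. A quasigroup $(A,* )$ is paramedial if $(x*y)*(u*v)=(v*y)*(u*x)$ for all $x,y,u,v\in A$. Given an abelian group $G=(G,+)$, automorphisms $\varphi,\psi$ of $G$ and $c\in G$, let $\mathrm{Aff}(G,+,\varphi,\psi,c)$ denote the quasigroup on the set $G$ with operation $x*y=\varphi(x)+\psi(y)+c$. If a quasigroup equals $\mathrm{Aff}(G,+,\varphi,\psi,c)$, it is called affine over $G$ and the quintuple $(G,+,\varphi,\psi,c)$ is called an affine form of it. For a finite abelian group $G$, $\mathrm{pq}(G)$ denotes the number, up to isomorphism, of paramedial quasigroups that admit an affine form over $G$. $\mathbb{Z}_n$ denotes the cyclic group of order $n$, $\mathbb{Z}_p^2=\mathbb{Z}_p\times\mathbb{Z}_p$, and an empty sum equals $0$ (so the sum vanishes for $k=1$). *)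

(* Defs.v *)
From HB Require Import structures.
From mathcomp Require Import all_boot all_order all_fingroup all_algebra.

Set Implicit Arguments.
Unset Strict Implicit.
Unset Printing Implicit Defensive.

(* MathComp gives U * V a zmodType structure and a finType structure, but not
   their join.  The resulting group law is the componentwise addition. *)
HB.instance Definition _ (U V : finZmodType) := GRing.Zmodule.on (U * V)%type.

(* A finite function rather than T -> T -> T, so that the operations on T form
   a finType and can be counted; the value of a * b is q (a, b). *)
Definition binop (T : finType) := {ffun T * T -> T}.

Definition quasigroup (T : finType) (q : binop T) : bool :=
  [forall a, forall b,
    (#|[set x | q (a, x) == b]| == 1) && (#|[set y | q (y, a) == b]| == 1)].

Definition paramedial (T : finType) (q : binop T) : bool :=
  [forall x, forall y, forall u, forall v,
    q (q (x, y), q (u, v)) == q (q (v, y), q (u, x))].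

Definition qg_isom (T : finType) (q r : binop T) : bool :=
  [exists f : {perm T}, forall x, forall y, f (q (x, y)) == r (f x, f y)].

Definition Aff (G : finZmodType) (phi psi : {perm G}) (c : G) : binop G :=
  [ffun xy => phi xy.1 + psi xy.2 + c]%R.

(* The multiplicative finGroupType law underlying Aut [set: G] is the addition
   of G, so Aut [set: G] is the set of automorphisms of (G, +). *)
Definition affine_over (G : finZmodType) (q : binop G) : bool :=
  [exists phi in Aut [set: G], exists psi in Aut [set: G], exists c : G,
    q == Aff phi psi c].

(* Every quasigroup with an affine form over G has the carrier of G as its
   underlying set, so it is enough to classify operations on that set. *)
Definition pq (G : finZmodType) : nat :=
  #|equivalence_partition (@qg_isom G)
      [set q : binop G | [&& quasigroup q, paramedial q & affine_over q]]|.

(* Main.v *)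
Require Import Defs.
From mathcomp Require Import all_boot all_order all_fingroup all_algebra.
From mathcomp Require Import ring zify.

Set Implicit Arguments.
Unset Strict Implicit.
Unset Printing Implicit Defensive.

Import GRing.Theory.

(** An operation affine over G has the form a x + b y + c, for automorphisms a, b
    of G and a constant c, and it is paramedial exactly when a ^ 2 = b ^ 2. Every
    isomorphism between two such quasigroups is an affine bijection
    v |-> u v + d. Hence pq G counts the triples (a, b, c) with a ^ 2 = b ^ 2 up to
    simultaneous conjugation of a and b by u, where the constant changes into
    u c + (1 - a' - b') d and a', b' are the conjugates (pq_forms, form_isoP).

    Over a cyclic group of order p ^ k conjugation is trivial, and the orbits of
    constants are represented by the powers p ^ i that divide 1 - a - b
    (pq_cyclic). For odd p one has b = a or b = - a: the case b = - a gives one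
    class for each unit a, the case b = a leads to counting the units a such
    that p ^ i divides 1 - 2 a (pq_cyclic_odd). For p = 2 the number 1 - a - b is
    odd, and the classes are the pairs made of a unit and a square root of 1, of
    which there are four when k > 2 (pq_cyclic_two, sqrt1_sub).

    Over the plane F x F, with F of prime order, a and b are invertible matrices
    A and B. A conjugacy class of pairs (A, B) gives one class of quasigroups
    with constant 0, and exactly one more if 1 - A - B is singular (pq_plane).
    It remains to count conjugacy classes of pairs. In odd characteristic,
    A ^ 2 = B ^ 2 means that S = A + B and D = A - B anticommute, and the extra
    classes come from the pairs such that 1 is an eigenvalue of S
    (nclasses_anticommuting). Anticommuting pairs of matrices of order 2 fall
    into few families (Qclasses_anticommuting): S or D is 0; or S and D are
    rank 1 matrices with product 0; or both are traceless, and one of them is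
    nilpotent; or both are traceless and invertible, so that they generate a
    quaternion algebra. The last family is the delicate one. As
    every quaternion algebra over a finite field splits, all non-zero
    values of S ^ 2 and D ^ 2 occur (norm_form_surj), and these two scalars
    determine the pair up to conjugacy, by Hilbert 90 (quaternion_pair_conj).
    With q elements in F, there are 4 q ^ 2 - 3 q - 1 classes of pairs, of which
    3 q - 1 are singular. Over the field with two elements, six pairs represent
    all classes, and one of them is singular. *)

(** * Counting equivalence classes *)

(** The size of an image depends only on which points share a fibre; this
    compares two sets of classes without exhibiting a map between them. *)
Lemma card_imset_kernel (T U V : finType) (g : T -> U) (h : T -> V)
    (P : {set T}) :
    {in P &, forall x y, (g x == g y) = (h x == h y)} ->
  #|g @: P| = #|h @: P|.
Proof.
move=> gh; case: (set_0Vmem P) => [-> | [x0 Px0]]; first by rewrite !imset0 !cards0.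
pose s A := odflt x0 [pick x in P | g x == A].
have sP x : x \in P -> s (g x) \in P /\ g (s (g x)) == g x.
  move=> Px; rewrite /s; case: pickP => [y /andP[] // | /(_ x)].
  by rewrite Px eqxx.
have -> : h @: P = (h \o s) @: (g @: P).
  rewrite -imset_comp; apply: eq_in_imset => x Px /=.
  by have [Psx gsx] := sP x Px; apply/esym/eqP; rewrite -gh.
rewrite [RHS]card_in_imset // => _ _ /imsetP[x Px ->] /imsetP[y Py ->] /= /eqP.
have [Psx /eqP gsx] := sP x Px; have [Psy /eqP gsy] := sP y Py.
by rewrite -gh // gsx gsy => /eqP.
Qed.

Section Classes.

Variables (X : finType) (E : rel X).
Hypothesis eqE : equivalence_rel E.

Definition nclasses (P : {set X}) : nat := #|equivalence_partition E P|.

(** The classes on the right are taken in the whole of X: the class of a point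
    no longer depends on P, and counts over different sets P can be compared. *)
Lemma nclassesE (P : {set X}) : nclasses P = #|(fun x => [set y | E x y]) @: P|.
Proof.
rewrite /nclasses /equivalence_partition.
apply: card_imset_kernel => x y Px Py.
have [_ Exy] := eqE x y y; have [Exx _] := eqE x x x; have [Eyy _] := eqE y y y.
apply/eqP/eqP => /setP/(_ y); rewrite !inE ?Py ?Eyy => xy; apply/setP=> z;
  rewrite !inE; have [_ H] := eqE x y z; by rewrite H.
Qed.

Lemma nclasses_split (Q : pred X) (P : {set X}) :
    {in P &, forall x y, E x y -> Q x = Q y} ->
  nclasses P = nclasses [set x in P | Q x] + nclasses [set x in P | ~~ Q x].
Proof.
move=> Qinv; rewrite !nclassesE.
have {1}-> : P = [set x in P | Q x] :|: [set x in P | ~~ Q x].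
  by apply/setP=> x; rewrite !inE; case: (x \in P); case: (Q x).
rewrite imsetU cardsU; set I := (_ :&: _); suff -> : I = set0 by rewrite cards0 subn0.
apply/eqP; rewrite -subset0; apply/subsetP => A.
case/setIP=> /imsetP[x]; rewrite inE => /andP[Px Qx] -> /imsetP[y].
rewrite inE => /andP[Py Qy] /setP/(_ y); have [Eyy _] := eqE y y y.
by rewrite !inE Eyy => /Qinv Qxy; rewrite Qxy // (negPf Qy) in Qx.
Qed.

End Classes.

(** The map f induces a bijection between the classes of E in P and those of
    E' in P'. *)
Lemma nclasses_reduce (X Y : finType) (E : rel X) (E' : rel Y)
    (P : {set X}) (P' : {set Y}) (f : X -> Y) :
    equivalence_rel E -> equivalence_rel E' ->
    {in P, forall x, f x \in P'} ->
    {in P &, forall x y, E x y = E' (f x) (f y)} ->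
    {in P', forall y, exists2 x, x \in P & E' (f x) y} ->
  nclasses E P = nclasses E' P'.
Proof.
move=> eqE eqE' fP fE fsurj; rewrite !nclassesE //.
have cls (Z : finType) (F : rel Z) : equivalence_rel F -> forall x y,
    ([set z | F x z] == [set z | F y z]) = F x y.
  move=> eqF x y; have [Fxx _] := eqF x x x; have [Fyy _] := eqF y y y.
  apply/eqP/idP => [/setP/(_ y) | xy]; first by rewrite !inE Fyy.
  by apply/setP=> z; rewrite !inE; have [_ ->] := eqF x y z.
have -> : (fun y => [set z | E' y z]) @: P' = (fun x => [set z | E' (f x) z]) @: P.
  apply/setP=> A; apply/imsetP/imsetP => [[y P'y ->] | [x Px ->]]; last first.
    by exists (f x) => //; apply: fP.
  by have [x Px xy] := fsurj y P'y; exists x => //; apply/esym/eqP; rewrite cls.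
by apply: card_imset_kernel => x y Px Py; rewrite !cls // fE.
Qed.

(** The labels J are the classes of the relation of equality, so this is
    nclasses_reduce applied to the map sending a label to its normal form. *)
Lemma nclasses_reps (X I : finType) (E : rel X) (P : {set X}) (J : {set I})
    (rep : I -> X) :
    equivalence_rel E ->
    {in J, forall i, rep i \in P} ->
    {in J &, forall i j, E (rep i) (rep j) -> i = j} ->
    {in P, forall x, exists2 i, i \in J & E (rep i) x} ->
  nclasses E P = #|J|.
Proof.
move=> eqE repP repI repS.
have eqI : equivalence_rel (@eq_op I) by move=> i j k; split=> [|/eqP->].
rewrite -(nclasses_reduce (f := rep) (P := J) eqI) //; last first.
  move=> i j Ji Jj /=; apply/eqP/idP => [-> | /repI-> //].
  by have [] := eqE (rep j) (rep j) (rep j).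
rewrite nclassesE //; set g := fun _ => _.
rewrite card_in_imset // => i j _ _ /setP/(_ j).
by rewrite !inE eqxx => /eqP.
Qed.

(** A family of normal forms, once established for P, also counts the classes
    of every part of P cut out by an invariant predicate. *)
Lemma nclasses_reps_inv (X I : finType) (E : rel X) (P : {set X}) (J : {set I})
    (rep : I -> X) (Q : pred X) :
    equivalence_rel E ->
    (forall x y, E x y -> Q x -> Q y) ->
    {in J, forall i, rep i \in P} ->
    {in J &, forall i j, E (rep i) (rep j) -> i = j} ->
    {in P, forall x, exists2 i, i \in J & E (rep i) x} ->
  nclasses E [set x in P | Q x] = #|[set i in J | Q (rep i)]|.
Proof.
move=> eqE Qinv repP repI repS; apply: (nclasses_reps (rep := rep)) => //.
- by move=> i; rewrite !inE => /andP[/repP-> ->].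
- by move=> i j; rewrite !inE => /andP[Ji _] /andP[Jj _]; apply: repI.
move=> x; rewrite inE => /andP[/repS[i Ji ix] Qx]; exists i => //.
rewrite inE Ji; apply: Qinv Qx; have [ii /(_ ix) <-] := eqE (rep i) x (rep i).
exact: ii.
Qed.

Local Open Scope ring_scope.

(** * Affine forms and their isomorphisms *)

Lemma qg_isom_equivalence (T : finType) : equivalence_rel (@qg_isom T).
Proof.
have rfl q : @qg_isom T q q.
  by apply/existsP; exists 1%g; do 2!apply/forallP=> ?; rewrite !permE.
have trs q r s : @qg_isom T q r -> qg_isom r s -> qg_isom q s.
  case/existsP=> f Hf /existsP[g Hg]; apply/existsP; exists (f * g)%g.
  apply/forallP=> x; apply/forallP=> y; rewrite !permM.
  move/forallP/(_ x)/forallP/(_ y)/eqP: Hf => ->.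
  by move/forallP/(_ (f x))/forallP/(_ (f y))/eqP: Hg => ->.
have sym q r : @qg_isom T q r -> qg_isom r q.
  case/existsP=> f Hf; apply/existsP; exists f^-1%g.
  apply/forallP=> x; apply/forallP=> y; apply/eqP/(@perm_inj _ f); rewrite permKV.
  by move/forallP/(_ (f^-1%g x))/forallP/(_ (f^-1%g y))/eqP: Hf => ->; rewrite !permKV.
move=> q r s; split=> // qr; apply/idP/idP; apply: trs => //; exact: sym.
Qed.

Lemma AutTP (G : finZmodType) (f : {perm G}) :
  reflect {morph f : x y / x + y} (f \in Aut [set: G]).
Proof.
apply: (iffP idP) => [Af x y | fD].
  by move: Af; rewrite inE => /andP[_ /morphicP]; apply; rewrite inE.
rewrite inE; apply/andP; split; first by apply/subsetP=> x; rewrite inE.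
by apply/morphicP => x y _ _; apply: fD.
Qed.

(** A presentation of R as the whole endomorphism ring of G. It serves both
    'Z_n acting on itself and the 2 x 2 matrices over a prime field. *)
Record full_action (G : finZmodType) (R : finUnitRingType) (app : R -> G -> G) :
    Prop := FullAction {
  full_appDr : forall r, {morph app r : v w / v + w};
  full_appDl : forall r s v, app (r + s) v = app r v + app s v;
  full_appM : forall r s v, app (r * s) v = app r (app s v);
  full_app1 : forall v, app 1 v = v;
  full_app_inj : forall r s, app r =1 app s -> r = s;
  full_app_onto : forall f : G -> G, {morph f : v w / v + w} ->
    exists r, f =1 app r }.

Section AffineForms.

Variables (G : finZmodType) (R : finUnitRingType) (app : R -> G -> G).
Hypothesis appF : full_action app.

Let appDr := full_appDr appF.
Let appDl := full_appDl appF.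
Let appM := full_appM appF.
Let app1 := full_app1 appF.
Let app_inj := full_app_inj appF.
Let app_onto := full_app_onto appF.

Lemma app_0r r : app r 0 = 0.
Proof. by apply: (addrI (app r 0)); rewrite -appDr !addr0. Qed.

Lemma app_0l v : app 0 v = 0.
Proof. by apply: (addrI (app 0 v)); rewrite -appDl !addr0. Qed.

Lemma app_Nl r v : app (- r) v = - app r v.
Proof. by apply: (addrI (app r v)); rewrite -appDl !subrr app_0l. Qed.

Lemma app_K u : u \is a GRing.unit -> cancel (app u) (app u^-1).
Proof. by move=> Uu v; rewrite -appM mulVr ?app1. Qed.

Lemma app_VK u : u \is a GRing.unit -> cancel (app u^-1) (app u).
Proof. by move=> Uu v; rewrite -appM mulrV ?app1. Qed.

(** The inverse of a bijective additive map is additive, hence comes from R. *)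
Lemma app_bij_unit u : bijective (app u) -> u \is a GRing.unit.
Proof.
case=> g gK Kg.
have gD : {morph g : v w / v + w}.
  by move=> v w; apply: (can_inj gK); rewrite appDr !Kg.
have [r gr] := app_onto gD.
apply/unitrP; exists r; split; apply: app_inj => v; rewrite appM app1 -gr.
  exact: gK.
exact: Kg.
Qed.

Lemma Aut_app (f : {perm G}) : f \in Aut [set: G] ->
  exists2 u, u \is a GRing.unit & f =1 app u.
Proof.
move/AutTP=> fD; have [u fu] := app_onto fD; exists u => //.
apply: app_bij_unit; apply: (eq_bij _ fu).
exact: (Bijective (permK f) (permKV f)).
Qed.

Lemma app_Aut u : u \is a GRing.unit ->
  exists2 f : {perm G}, f \in Aut [set: G] & f =1 app u.
Proof.
move=> Uu; exists (perm (can_inj (app_K Uu))) => [|v]; last by rewrite permE.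
by apply/AutTP=> v w; rewrite !permE appDr.
Qed.

Definition affine_op (x : R * R * G) : binop G :=
  [ffun z => app x.1.1 z.1 + app x.1.2 z.2 + x.2].

(** Triples are compared through the quasigroups they define, which makes this
    an equivalence relation for free; form_isoP gives the algebraic meaning. *)
Definition form_iso : rel (R * R * G) :=
  fun x y => qg_isom (affine_op x) (affine_op y).

Definition forms : {set R * R * G} :=
  [set x | [&& x.1.1 \is a GRing.unit, x.1.2 \is a GRing.unit
             & x.1.1 ^+ 2 == x.1.2 ^+ 2]].

Lemma form_iso_equivalence : equivalence_rel form_iso.
Proof. by move=> x y z; apply: qg_isom_equivalence. Qed.

Lemma quasigroup_affine_op x : x.1.1 \is a GRing.unit -> x.1.2 \is a GRing.unit ->
  quasigroup (affine_op x).
Proof.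
case: x => [[a b] c] /= Ua Ub; apply/forallP=> v; apply/forallP=> w.
apply/andP; split; apply/cards1P.
  exists (app b^-1 (w - c - app a v)); apply/setP=> z.
  rewrite !inE ffunE /= -(can2_eq (app_K Ub) (app_VK Ub)) [RHS]eq_sym !subr_eq.
  by rewrite eq_sym [app b z + _]addrC.
exists (app a^-1 (w - c - app b v)); apply/setP=> z.
rewrite !inE ffunE /= -(can2_eq (app_K Ua) (app_VK Ua)) [RHS]eq_sym !subr_eq.
by rewrite eq_sym.
Qed.

(** In the paramedial law the terms in y and u and the constants agree on both
    sides, while x and v get the coefficients a ^ 2 and b ^ 2 on one side and
    b ^ 2 and a ^ 2 on the other. *)
Lemma paramedial_affine_op x :
  paramedial (affine_op x) = (x.1.1 ^+ 2 == x.1.2 ^+ 2).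
Proof.
case: x => [[a b] c] /=; apply/idP/eqP => [pm | ab].
  apply: app_inj => v; rewrite !expr2 !appM.
  move/forallP/(_ v)/forallP/(_ 0)/forallP/(_ 0)/forallP/(_ 0)/eqP: pm.
  rewrite !ffunE /= !appDr !app_0r !addr0 !add0r.
  rewrite [RHS](AC (1*2*1) (2*(1*3*4))) /= -!addrA.
  exact: addIr.
apply/forallP=> s; apply/forallP=> t; apply/forallP=> u; apply/forallP=> v.
rewrite !ffunE /= !appDr -!appM -!expr2 ab; apply/eqP; congr (_ + _).
by rewrite [LHS](AC (3*3) ((5*2*3)*(4*1*6))).
Qed.

Lemma affine_overP (q : binop G) :
  reflect (exists x, [/\ x.1.1 \is a GRing.unit, x.1.2 \is a GRing.unit
                       & q = affine_op x]) (affine_over q).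
Proof.
apply: (iffP existsP) => [[f /andP[Af]] | [[[a b] c] [/= Ua Ub ->]]].
  case/existsP=> g /andP[Ag /existsP[c /eqP->]].
  have [a Ua fa] := Aut_app Af; have [b Ub gb] := Aut_app Ag.
  by exists (a, b, c); split=> //; apply/ffunP=> z; rewrite !ffunE /= fa gb.
have [f Af fa] := app_Aut Ua; have [g Ag gb] := app_Aut Ub.
exists f; rewrite Af; apply/existsP; exists g; rewrite Ag; apply/existsP; exists c.
by apply/eqP/ffunP=> z; rewrite !ffunE /= fa gb.
Qed.

Theorem pq_forms : pq G = nclasses form_iso forms.
Proof.
symmetry; apply: (nclasses_reduce (f := affine_op)).
- exact: form_iso_equivalence.
- exact: qg_isom_equivalence.
- move=> x; rewrite !inE => /and3P[Ua Ub ab].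
  rewrite quasigroup_affine_op // paramedial_affine_op ab /=.
  by apply/affine_overP; exists x.
- by [].
move=> q; rewrite inE => /and3P[_ pm /affine_overP[x [Ua Ub qx]]].
exists x; first by rewrite inE Ua Ub -paramedial_affine_op -qx.
by rewrite qx; have [] := qg_isom_equivalence (affine_op x) (affine_op x) (affine_op x).
Qed.

(** An isomorphism f of affine quasigroups is an affine map v |-> u v + d: its
    linear part conjugates the automorphisms, and the images of 0 under the two
    sides of the homomorphism law give the equation on y.2. *)
Lemma form_isoP (x y : R * R * G) : x \in forms -> y \in forms ->
  reflect (exists u d, [/\ u \is a GRing.unit, u * x.1.1 = y.1.1 * u,
             u * x.1.2 = y.1.2 * u
           & y.2 = app u x.2 + d - app (y.1.1 + y.1.2) d]) (form_iso x y).
Proof.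
case: x y => [[a b] c] [[a' b'] c']; rewrite !inE /= => /and3P[Ua Ub _] _.
apply: (iffP existsP) => /= [[f] | [u [d [Uu ua ub ->]]]]; last first.
  have fI : injective (fun v => app u v + d).
    by move=> v w /addIr /(can_inj (app_K Uu)).
  exists (perm fI); apply/forallP=> v; apply/forallP=> w; apply/eqP.
  rewrite !permE !ffunE /= !appDr appDl -!appM ua ub.
  set V := app (a' * u) v; set W := app (b' * u) w.
  rewrite opprD; apply/esym.
  rewrite [LHS](AC (2*2*(2*2)) ((1*3*5*6)*((2*7)*(4*8)))) /=.
  by rewrite !subrr !addr0.
move/forallP=> fE.
have {}fE v w : f (app a v + app b w + c) = app a' (f v) + app b' (f w) + c'.
  by move/(_ v)/forallP/(_ w)/eqP: fE; rewrite !ffunE.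
(* The functional equation at (s, t), (0, 0), (s, 0) and (0, t) eliminates a',
   b' and c' and shows that f is affine around c; two instances of the result
   move the base point from c to 0. *)
have fD v w : f (v + w) + f 0 = f v + f w.
  have E s t : f (s + t + c) + f c = f (s + c) + f (t + c).
    have fs := fE (app a^-1 s) (app b^-1 t).
    have f0 := fE 0 0.
    have f1 := fE (app a^-1 s) 0.
    have f2 := fE 0 (app b^-1 t).
    move: fs f0 f1 f2; rewrite !app_0r !app_VK // !addr0 !add0r => -> -> -> ->.
    by rewrite [LHS](AC (3*3) ((1*5*3)*(4*2*6))).
  have := congr2 +%R (E (v - c) w) (esym (E (- c) w)).
  rewrite ![_ + w + c]addrAC subrK addNr add0r.
  rewrite [LHS](AC (2*2) (1*3*(2*4))) [RHS](AC (2*2) (1*3*(2*4))) /=.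
  by rewrite [f c + _]addrC; exact: addIr.
pose g v := f v - f 0.
have gD : {morph g : v w / v + w}.
  move=> v w; rewrite /g; apply: (addIr (f 0 + f 0)).
  by rewrite addrA subrK fD [RHS](AC (2*2*2) (1*3*(2*5)*(4*6))) /= !addNr !addr0.
have [u gu] := app_onto gD.
have fu v : f v = app u v + f 0 by rewrite -gu subrK.
have Uu : u \is a GRing.unit.
  apply: app_bij_unit; apply: (eq_bij _ gu).
  exists (fun v => f^-1%g (v + f 0)) => v; rewrite /g.
    by rewrite subrK permK.
  by rewrite permKV addrK.
have fE0 : app u c + f 0 = app a' (f 0) + app b' (f 0) + c'.
  by rewrite -fu -fE !app_0r !add0r.
exists u, (f 0); split=> //; last by rewrite fE0 -appDl addrC addrA addNr add0r.
  apply: app_inj => v; rewrite !appM.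
  have := fE v 0; rewrite (fu v) (fu (_ + c)) !appDr !app_0r !addr0.
  rewrite -[LHS]addrA fE0 [RHS](AC (2*1*1) (1*(2*3*4))) /=.
  exact: addIr.
apply: app_inj => v; rewrite !appM.
have := fE 0 v; rewrite (fu v) (fu (_ + c)) !appDr !app_0r !add0r.
rewrite -[LHS]addrA fE0 [RHS](AC (1*2*1) (2*(1*3*4))) /=.
exact: addIr.
Qed.

End AffineForms.

(** * Cyclic groups of prime power order *)

Section CyclicPrimePower.

Variables (p k : nat).
Hypotheses (p_pr : prime p) (k_gt0 : (0 < k)%N).

Local Notation Zpk := 'Z_(p ^ k).

Let pk_gt1 : (1 < p ^ k)%N.
Proof. by rewrite -(expn0 p) ltn_exp2l ?prime_gt1. Qed.

Let p_gt0 : (0 < p)%N := prime_gt0 p_pr.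

Let valM (x y : Zpk) : nat_of_ord (x * y)%R = ((nat_of_ord x * nat_of_ord y) %% p ^ k)%N.
Proof. by rewrite /=; congr modn; apply: Zp_cast. Qed.

Let valD (x y : Zpk) : nat_of_ord (x + y)%R = ((nat_of_ord x + nat_of_ord y) %% p ^ k)%N.
Proof. by rewrite /=; congr modn; apply: Zp_cast. Qed.

Let dvd_mod i m : (i <= k)%N -> (p ^ i %| m %% p ^ k)%N = (p ^ i %| m)%N.
Proof. by move=> ik; rewrite /dvdn modn_dvdm // dvdn_exp2l. Qed.

Lemma Zp_mul_additive (f : Zpk -> Zpk) :
  {morph f : v w / v + w} -> exists r, f =1 *%R r.
Proof.
move=> fD; exists (f 1) => v; rewrite -[v in LHS]natr_Zp -[v in RHS]natr_Zp.
have f0 : f 0 = 0 by apply: (addrI (f 0)); rewrite -fD !addr0.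
elim: (v : nat) => [|m IH]; first by rewrite mulr0.
by rewrite !mulrSr fD IH mulrDr mulr1.
Qed.

Lemma Zp_full_action : full_action (fun r v : Zpk => r * v).
Proof.
split; [exact: mulrDr | exact: mulrDl | by move=> r s v; rewrite mulrA
       | exact: mul1r | | exact: Zp_mul_additive].
by move=> r s /(_ 1); rewrite !mulr1.
Qed.

(** Divisibility by p ^ i in the local ring 'Z_(p ^ k), where it is compatible
    with the ring operations as long as i <= k. *)
Definition pdvd i (x : Zpk) := (p ^ i %| (x : nat))%N.

Lemma pdvdD i x y : (i <= k)%N -> pdvd i x -> pdvd i y -> pdvd i (x + y).
Proof. by move=> ik; rewrite /pdvd valD dvd_mod //; apply: dvdn_add. Qed.

Lemma pdvd_mulr i x y : (i <= k)%N -> pdvd i x -> pdvd i (x * y).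
Proof. by move=> ik; rewrite /pdvd valM dvd_mod //; apply: dvdn_mulr. Qed.

Lemma pdvd_pexp i j : (i <= k)%N -> pdvd i (p%:R ^+ j) = (i <= j)%N.
Proof.
move=> ik; rewrite /pdvd -natrX val_Zp_nat // dvd_mod //.
by rewrite dvdn_Pexp2l ?prime_gt1.
Qed.

Lemma pdvd_unit u : (u \is a GRing.unit) = ~~ pdvd 1 u.
Proof.
by rewrite -[u in LHS]natr_Zp unitZpE // coprime_pexpl // prime_coprime // /pdvd expn1.
Qed.

(** The exponent j is the p-adic valuation capped at k; 0 has exponent k. *)
Lemma unit_pexp_decomp (x : Zpk) :
  exists w j, [/\ w \is a GRing.unit, (j <= k)%N & x = w * p%:R ^+ j].
Proof.
have [x0|x_neq0] := posnP (x : nat).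
  exists 1, k; split; rewrite ?unitr1 // mul1r -natrX; apply: val_inj.
  by rewrite /= x0 val_Zp_nat // modnn.
have [m pm xE] := pfactor_coprime p_pr x_neq0; exists m%:R, (logn p x).
split; first by rewrite unitZpE // coprime_pexpl.
  have lx : (p ^ logn p x < p ^ k)%N.
    apply: leq_ltn_trans (dvdn_leq x_neq0 (pfactor_dvdnn _ _)) _.
    by have := ltn_ord x; rewrite [X in (_ < X)%N]Zp_cast.
  by apply: ltnW; rewrite ltn_exp2l ?prime_gt1 in lx.
by rewrite -natrX -natrM -xE natr_Zp.
Qed.

(** A label (a, b, i) stands for the triple (a, b, p ^ i). *)
Definition cyclic_labels : {set Zpk * Zpk * 'I_k.+1} :=
  [set t : Zpk * Zpk * 'I_k.+1 | [&& t.1.1 \is a GRing.unit, t.1.2 \is a GRing.unit,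
               t.1.1 ^+ 2 == t.1.2 ^+ 2 & pdvd t.2 (1 - t.1.1 - t.1.2)]].

(** Conjugation is trivial in a commutative ring, so a class consists of a pair
    (a, b) and an orbit of constants under multiplication by units and
    translation by multiples of 1 - a - b. Such an orbit contains exactly one
    p ^ i with i at most the valuation of 1 - a - b, namely the minimum of that
    valuation and of the valuation of the constant. *)
Lemma pq_cyclic : pq Zpk = #|cyclic_labels|.
Proof.
have appF := Zp_full_action; have isoP := form_isoP appF.
rewrite (pq_forms appF).
pose rep (t : Zpk * Zpk * 'I_k.+1) := (t.1, p%:R ^+ t.2 : Zpk).
have rep_form t : t \in cyclic_labels -> rep t \in forms Zpk Zpk.
  by rewrite !inE => /and4P[-> ->].
apply: (nclasses_reps (rep := rep)); first exact: form_iso_equivalence.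
- exact: rep_form.
- move=> s t Js Jt /(isoP _ _ (rep_form s Js) (rep_form t Jt)) [u [d []]].
  case: s t Js Jt => [[a b] i] [[a' b'] j] /=; rewrite !inE /=.
  case/and4P=> _ _ _ iab /and4P[_ _ _ jab] Uu.
  rewrite ![u * _]mulrC => /(mulIr Uu) eqa /(mulIr Uu) eqb ij; subst a' b'.
  congr (_, _, _); apply/val_inj/eqP; rewrite /= eqn_leq.
  have ik : (i <= k)%N by rewrite -ltnS.
  have jk : (j <= k)%N by rewrite -ltnS.
  have {}ij : p%:R ^+ j = p%:R ^+ i * u + (1 - a - b) * d.
    by rewrite ij /app; ring.
  (* Both exponents are at most the valuation of 1 - a - b, so ij gives i <= j,
     and solving it for p ^ i gives j <= i. *)
  rewrite -(pdvd_pexp j ik) ij pdvdD ?pdvd_mulr ?pdvd_pexp //=.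
  rewrite -(pdvd_pexp i jk) [p%:R ^+ i](_ : _ = (p%:R ^+ j - (1 - a - b) * d) * u^-1).
    rewrite pdvd_mulr // pdvdD ?pdvd_pexp // -mulrN pdvd_mulr //.
  by rewrite ij addrK mulrK.
move=> [[a b] c] Fx; have := Fx; rewrite inE /= => /and3P[Ua Ub ab].
have [w [j [Uw jk cE]]] := unit_pexp_decomp c.
have [w' [l [Uw' lk mE]]] := unit_pexp_decomp (1 - a - b).
have [jl | lj] := leqP j l.
  have Jt : (a, b, Ordinal (jk : (j < k.+1)%N)) \in cyclic_labels.
    by rewrite inE /= Ua Ub ab /= mE mulrC pdvd_mulr ?pdvd_pexp.
  exists (a, b, Ordinal (jk : (j < k.+1)%N)) => //.
  apply/(isoP _ _ (rep_form _ Jt) Fx); exists w, 0; split=> //=; try exact: mulrC.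
  by rewrite !mulr0 addr0 subr0.
(* Now 1 - a - b divides both c and p ^ l, so a translation takes one to the
   other. *)
have Jt : (a, b, Ordinal (lk : (l < k.+1)%N)) \in cyclic_labels.
  by rewrite inE /= Ua Ub ab /= mE mulrC pdvd_mulr ?pdvd_pexp.
exists (a, b, Ordinal (lk : (l < k.+1)%N)) => //.
apply/(isoP _ _ (rep_form _ Jt) Fx); exists 1, (w'^-1 * (w * p%:R ^+ (j - l) - 1)).
split=> /=; rewrite ?unitr1 ?mul1r ?mulr1 //.
set d := w'^-1 * _.
have -> : p%:R ^+ l + d - (a + b) * d = p%:R ^+ l + (1 - a - b) * d by ring.
rewrite mE mulrAC /d mulVKr // cE -(subnK (ltnW lj)) exprD addnK.
ring.
Qed.

Lemma card_pdvd i : (i <= k)%N -> #|[set x : Zpk | pdvd i x]| = (p ^ (k - i))%N.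
Proof.
move=> ik; have pi_gt0 : (0 < p ^ i)%N by rewrite expn_gt0 p_gt0.
have pkE : (p ^ k = p ^ i * p ^ (k - i))%N by rewrite -expnD subnKC.
pose f (j : 'I_(p ^ (k - i))) : Zpk := (p ^ i * j)%:R.
have valf j : nat_of_ord (f j) = (p ^ i * j)%N.
  by rewrite val_Zp_nat // modn_small // pkE ltn_pmul2l.
rewrite -[RHS]card_ord -(card_imset (f := f)); last first.
  move=> j j' /(congr1 (@nat_of_ord _)); rewrite !valf => /eqP.
  by rewrite eqn_pmul2l // => /eqP/val_inj.
apply: eq_card => x; rewrite inE; apply/idP/imsetP => [px | [j _ ->]]; last first.
  by rewrite /pdvd valf dvdn_mulr.
have xlt : (x %/ p ^ i < p ^ (k - i))%N.
  rewrite ltn_divLR // mulnC -pkE.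
  by have := ltn_ord x; rewrite [X in (_ < X)%N]Zp_cast.
exists (Ordinal xlt) => //; apply: val_inj; rewrite [RHS]valf /=.
by rewrite mulnC divnK.
Qed.

Lemma card_unit_Zpk :
  #|[set u : Zpk | u \is a GRing.unit]| = (p ^ k - p ^ (k - 1))%N.
Proof.
rewrite -(card_pdvd k_gt0) -[X in (X - _)%N](Zp_cast pk_gt1) -[X in (X - _)%N]card_ord.
rewrite -(cardsC [set x : Zpk | pdvd 1 x]) addKn.
by apply: eq_card => x; rewrite !inE pdvd_unit.
Qed.

Lemma pdvd1_1 : ~~ pdvd 1 1.
Proof. by rewrite -pdvd_unit unitr1. Qed.

Lemma pdvdN i x : (i <= k)%N -> pdvd i x -> pdvd i (- x).
Proof. by move=> ik px; rewrite -mulrN1 pdvd_mulr. Qed.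

Lemma pdvd0 i : pdvd i 0.
Proof. exact: dvdn0. Qed.

End CyclicPrimePower.

Lemma card_set_pair (A B : finType) (P : A -> B -> bool) :
  #|[set t : A * B | P t.1 t.2]| = (\sum_b #|[set a | P a b]|)%N.
Proof.
rewrite -sum1_card (eq_bigl (fun t => P t.1 t.2)) => [|t]; last by rewrite inE.
rewrite -(pair_big_dep xpredT P (fun _ _ => 1%N)) (exchange_big_dep xpredT) //=.
by apply: eq_bigr => b _; rewrite -sum1_card; apply: eq_bigl => a; rewrite inE.
Qed.

(** Since (b - a) (b + a) = 0 and the factors add up to the unit 2 b, one of them
    is a unit in this local ring; hence b = a or b = - a. If b = - a then
    1 - a - b = 1 and only i = 0 occurs. If b = a, then for i > 0 the bijection
    a |-> 1 - 2 a identifies the units a to be counted with the p ^ (k - i)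
    multiples of p ^ i. *)
Theorem pq_cyclic_odd (p k : nat) : prime p -> odd p -> (0 < k)%N ->
  pq 'Z_(p ^ k) = (2 * p ^ k - p ^ (k - 1) + \sum_(0 <= i < k - 1) p ^ i)%N.
Proof.
move=> p_pr p_odd k_gt0; rewrite pq_cyclic //.
have pk_gt1 : (1 < p ^ k)%N by rewrite -(expn0 p) ltn_exp2l ?prime_gt1.
set Z := 'Z_(p ^ k).
have U2 : 2%:R \is a @GRing.unit Z.
  by rewrite unitZpE // coprimen2 oddX p_odd orbT.
pose U := [set u : Z | u \is a GRing.unit].
pose D i := [set a : Z | (a \is a GRing.unit) && pdvd i (1 - a - a)].
pose M : {set Z * Z * 'I_k.+1} := (fun a => (a, - a, ord0)) @: U.
pose P := (fun t : Z * 'I_k.+1 => (t.1, t.1, t.2))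
  @: [set t : Z * 'I_k.+1 | t.1 \in D t.2].
have -> : cyclic_labels p k = M :|: P.
  apply/setP => [[[a b] i]]; rewrite !inE /=.
  apply/and4P/orP => [[Ua Ub /eqP ab di] | ]; last first.
    case=> /imsetP[x]; rewrite !inE.
      move=> Ux [-> -> ->].
      by split; rewrite ?unitrN ?sqrrN // opprK subrK /pdvd dvd1n.
    by case/andP=> Ux dx [-> -> ->]; split.
  have ab0 : (b - a) * (b + a) = 0 by rewrite -subr_sqr ab subrr.
  have [Um | nUm] := boolP (b - a \is a GRing.unit).
    left; have ba : b = - a.
      by apply/eqP; rewrite -addr_eq0; apply/eqP/(mulrI Um); rewrite mulr0.
    have i0 : i = ord0.
      move: di; rewrite ba opprK subrK => di; apply: val_inj; apply/eqP.
      by rewrite /= -leqn0 -(@pdvd_pexp p k) // -ltnS.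
    by apply/imsetP; exists a; rewrite ?inE // ba i0.
  right; have ba : b = a.
    apply: subr0_eq; have [Up | nUp] := boolP (b + a \is a GRing.unit).
      by apply: (mulIr Up); rewrite mul0r.
    have : 2%:R * b \is a GRing.unit by rewrite unitrM U2.
    rewrite pdvd_unit // => /negP[].
    rewrite [2%:R * b](_ : _ = (b - a) + (b + a)); last by ring.
    by apply: pdvdD => //; rewrite -[pdvd _ _]negbK -pdvd_unit.
  by apply/imsetP; exists (a, i); rewrite ?inE /= ?ba // Ua /= -{2}ba.
(* b = a and b = - a would make 2 a both a unit and 0. *)
have MP0 : M :&: P = set0.
  apply/eqP; rewrite -subset0; apply/subsetP => _ /setIP[/imsetP[a Ua ->]].
  case/imsetP=> -[b i] _ /= [ab ba _]; move: Ua; rewrite inE => Ua.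
  have : 2%:R * a \is a GRing.unit by rewrite unitrM U2.
  by rewrite [_ * a](_ : _ = a - - a); [rewrite ba -ab subrr unitr0 | ring].
rewrite cardsU MP0 cards0 subn0 !card_imset; last 2 first.
- by move=> [a i] [b j] /= [-> _ ->].
- by move=> a b [].
have -> : #|[set t : Z * 'I_k.+1 | t.1 \in D t.2]| =
          (#|U| + \sum_(i < k) p ^ i)%N.
  rewrite (card_set_pair (fun a (i : 'I_k.+1) => a \in D i)) big_ord_recl /=.
  congr (_ + _)%N.
    by apply: eq_card => a; rewrite !inE /pdvd dvd1n andbT.
  rewrite [RHS](reindex_inj rev_ord_inj) /=; apply: eq_bigr => i _.
  rewrite -(@card_pdvd p k) //.
  rewrite -[LHS](@card_imset _ _ (fun a : Z => 1 - a - a)); last first.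
    move=> a b /= ab; apply: (mulrI U2).
    have -> : 2%:R * a = 1 - (1 - a - a) by ring.
    by rewrite ab; ring.
  apply: eq_card => m; rewrite [RHS]inE; apply/imsetP/idP => [[a] | dm].
    by rewrite !inE => /andP[_ da] ->.
  have mE : m = 1 - 2%:R^-1 * (1 - m) - 2%:R^-1 * (1 - m).
    have -> : 1 - 2%:R^-1 * (1 - m) - 2%:R^-1 * (1 - m)
            = 1 - 2%:R * 2%:R^-1 * (1 - m) by ring.
    by rewrite mulrV // mul1r opprB addrC subrK.
  exists (2%:R^-1 * (1 - m)) => //; rewrite !inE -mE [pdvd _ m]dm andbT.
  rewrite unitrMr ?unitrV // pdvd_unit //; apply: contra (pdvd1_1 p_pr k_gt0) => d1.
  have -> : 1 = (1 - m) + m by rewrite subrK.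
  by apply: pdvdD => //; apply: dvdn_trans dm; apply: dvdn_exp2l.
rewrite card_unit_Zpk // -(big_mkord xpredT (fun i => p ^ i)%N).
rewrite -[in X in (_ + (_ + X))%N](subnK k_gt0) addn1 big_nat_recr //=.
have : (p ^ (k - 1) <= p ^ k)%N by rewrite leq_exp2l ?prime_gt1 // leq_subr.
by set s := (\sum_(0 <= i < k - 1) _)%N; lia.
Qed.

(** * Cyclic groups of order a power of 2 *)

Section CyclicTwo.

Variable k : nat.
Hypothesis k_gt0 : (0 < k)%N.

Local Notation Z := 'Z_(2 ^ k).
Let two_pr : prime 2. Proof. by []. Qed.
Let k2_gt1 : (1 < 2 ^ k)%N.
Proof. by rewrite -{1}(expn0 2) ltn_exp2l. Qed.

Lemma pdvd1_addr1 (u : Z) : u \is a GRing.unit -> pdvd 1 (u + 1).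
Proof.
rewrite pdvd_unit // /pdvd expn1 -[u + 1](_ : (u.+1)%:R = _); last first.
  by rewrite mulrSr natr_Zp.
rewrite (val_Zp_nat k2_gt1) /dvdn modn_dvdm ?dvdn_exp //.
by rewrite -!/(dvdn 2 _) !dvdn2 /= negbK => ->.
Qed.

(** As a and b are odd, 1 - a - b is odd, hence a unit, and every constant can be
    translated to 1. What remains are the pairs (a, b), that is, a unit a and
    a square root b / a of 1. *)
Lemma pq_cyclic_two :
  pq Z = (2 ^ (k - 1) * #|[set e : Z | e ^+ 2 == 1%R]|)%N.
Proof.
rewrite pq_cyclic //.
have -> : (2 ^ (k - 1) = #|[set u : Z | u \is a GRing.unit]|)%N.
  by rewrite card_unit_Zpk //; have := expnSr 2 (k - 1); rewrite subn1 prednK //; lia.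
rewrite -cardsX -(card_in_imset (f := fun t : Z * Z => (t.1, t.1 * t.2, ord0 : 'I_k.+1))).
  apply: eq_card => -[[a b] i]; rewrite !inE /=.
  apply/and4P/imsetP => [[Ua Ub /eqP ab di] | [[u e]]]; last first.
    rewrite !inE /= => /andP[Uu /eqP e1] [-> -> ->].
    have Ue : e \is a GRing.unit by rewrite -(unitrX_pos e (n := 2)) // e1 unitr1.
    by split; rewrite ?unitrM ?Uu // ?exprMn ?e1 ?mulr1 // /pdvd dvd1n.
  exists (a, a^-1 * b).
    by rewrite !inE Ua /= exprMn exprVn -ab mulVr ?unitrX.
  rewrite /= mulVKr //; congr (_, _); apply/val_inj/eqP; rewrite /= -leqn0 leqNgt.
  have ik : (i <= k)%N by rewrite -ltnS.
  apply/negP => i_gt0; have {}di : pdvd 1 (1 - a - b) by apply: dvdn_trans di; apply: dvdn_exp2l.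
  move: Ub; rewrite pdvd_unit // => /negP[].
  have -> : b = (a + 1) + (- (1 - a - b) + - (2%:R * a)) by ring.
  apply: pdvdD => //; first exact: pdvd1_addr1.
  apply: pdvdD => //; apply: pdvdN => //; apply: pdvd_mulr => //.
  by rewrite (@pdvd_pexp 2 k _ _ 1 1).
move=> [u e] [v f]; rewrite !inE /= => /andP[Uu _] _ E.
have := congr1 (fun t => t.1.2) E; have /= <- := congr1 (fun t => t.1.1) E.
by move/(mulrI Uu) => ->.
Qed.

(** If 2 y = 0 and y is not 0, then y = w 2 ^ (k - 1) for an odd w, and w may be
    replaced by 1 because w - 1 is even. *)
Lemma two_torsion (y : Z) : 2%:R * y = 0 -> y = 0 \/ y = 2%:R ^+ (k - 1).
Proof.
have [w [j [Uw jk ->]]] := unit_pexp_decomp two_pr k_gt0 y => y0.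
have : pdvd k (2%:R ^+ j.+1 : Z).
  rewrite -[_ ^+ _](mulKr Uw) [w * _](_ : _ = 0) ?mulr0 ?pdvd0 //.
  by rewrite -y0 exprS; ring.
have z0 : (2%:R ^+ k : Z) = 0.
  by rewrite -natrX; apply: val_inj; rewrite /= val_Zp_nat // modnn.
rewrite pdvd_pexp // => kj; have [-> | jk' ] := eqVneq j k; first by left; rewrite z0 mulr0.
right; have -> : (j = k - 1)%N by lia.
have /eqP : w * 2%:R ^+ (k - 1) - 2%:R ^+ (k - 1) = 0; last by rewrite subr_eq0 => /eqP.
have [t [l [Ut lk wE]]] := unit_pexp_decomp two_pr k_gt0 (w + 1).
have : pdvd 1 (w + 1) by apply: pdvd1_addr1.
rewrite -[pdvd _ _]negbK -pdvd_unit // wE; case: l lk wE => [|l] lk wE.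
  by rewrite mulr1 Ut.
move=> _; have kS : k = (k - 1).+1 by rewrite subn1 prednK.
have -> : w * 2%:R ^+ (k - 1) - 2%:R ^+ (k - 1)
        = (w + 1) * 2%:R ^+ (k - 1) - 2%:R * 2%:R ^+ (k - 1) by ring.
rewrite -exprS -kS z0 subr0 wE exprSr -!mulrA -exprS -kS z0.
by rewrite !mulr0.
Qed.

(** One of the even numbers e - 1 and e + 1 is twice a unit; their product being
    0, twice the other one vanishes, and two_torsion applies to it. *)
Lemma sqrt1_sub (e : Z) : e ^+ 2 = 1 ->
  e \in [:: 1; -1; 1 + 2%:R ^+ (k - 1); -1 + 2%:R ^+ (k - 1)].
Proof.
move=> e1; have Ue : e \is a GRing.unit.
  by rewrite -(unitrX_pos e (n := 2)) // e1 unitr1.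
have [w [j [Uw jk eE]]] := unit_pexp_decomp two_pr k_gt0 (e - 1).
have prod0 : (e - 1) * (e + 1) = 0.
  have -> : (e - 1) * (e + 1) = e ^+ 2 - 1 by ring.
  by rewrite e1 subrr.
have pd2 (x : Z) : pdvd 1 (2%:R * x) by rewrite pdvd_mulr // (@pdvd_pexp 2 k _ _ 1 1).
have em1 : pdvd 1 (e - 1).
  have -> : e - 1 = (e + 1) + - (2%:R * 1) by ring.
  by rewrite pdvdD ?pdvdN ?pdvd1_addr1.
rewrite !inE; case: j jk eE => [|[|j]] jk eE.
- by move: em1; rewrite -[pdvd _ _]negbK -pdvd_unit // eE mulr1 Uw.
- have : 2%:R * (e + 1) = 0.
    apply: (mulrI Uw); rewrite mulr0 -prod0 eE; ring.
  case/two_torsion => [/eqP | <-]; first by rewrite addr_eq0 => ->; rewrite orbT.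
  by rewrite [- 1 + _](_ : _ = e) ?eqxx ?orbT //; ring.
have Uv : w * 2%:R ^+ j.+1 + 1 \is a GRing.unit.
  rewrite pdvd_unit //; apply: contra (pdvd1_1 two_pr k_gt0) => d1.
  have -> : 1 = (w * 2%:R ^+ j.+1 + 1) + - (2%:R * (w * 2%:R ^+ j)) :> Z.
    by rewrite exprS; ring.
  by rewrite pdvdD ?pdvdN.
have : 2%:R * (e - 1) = 0.
  apply: (mulIr Uv); rewrite mul0r -prod0.
  have -> : e + 1 = 2%:R + (e - 1) by ring.
  by rewrite {3}eE [_ ^+ j.+2]exprS; ring.
case/two_torsion => /eqP; first by rewrite subr_eq0 => ->.
by rewrite subr_eq addrC => ->; rewrite !orbT.
Qed.

End CyclicTwo.

(** Here h = 2 ^ (k - 1) differs from 0 and from 2, which makes the four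
    candidates of sqrt1_sub distinct; they are roots because 2 h = h ^ 2 = 0. *)
Theorem pq_cyclic_two_large (k : nat) : (2 < k)%N -> pq 'Z_(2 ^ k) = (2 ^ (k + 1))%N.
Proof.
move=> k2; have k_gt0 : (0 < k)%N by apply: ltn_trans k2.
rewrite pq_cyclic_two // (_ : 2 ^ (k + 1) = 2 ^ (k - 1) * 4)%N; last first.
  by rewrite -(expnD 2 _ 2); congr expn; lia.
congr muln; set Z := 'Z_(2 ^ k); set h : Z := 2%:R ^+ (k - 1).
have pE (i j : nat) : (i <= k)%N -> pdvd i (2%:R ^+ j : Z) = (i <= j)%N.
  by move=> ik; apply: pdvd_pexp.
have h2 : 2%:R * h = 0.
  rewrite /h -exprS subn1 prednK // -natrX; apply: val_inj.
  by rewrite /= val_Zp_nat ?modnn // -{1}(expn0 2) ltn_exp2l.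
have hh : h ^+ 2 = 0.
  rewrite expr2 {1}/h (_ : (k - 1)%N = (k - 2).+1); last by lia.
  by rewrite exprSr -mulrA h2 mulr0.
have two0 : 2%:R != 0 :> Z.
  by apply/eqP=> /(congr1 (pdvd k)); rewrite (pE k 1%N) // pdvd0; lia.
have h0 : h != 0.
  by apply/eqP=> /(congr1 (pdvd k)); rewrite /h pE // pdvd0; lia.
have hn2 : h != 2%:R.
  by apply/eqP=> /(congr1 (pdvd (k - 1))); rewrite /h pE ?(pE _ 1%N); lia.
have hN : - h = h by apply/eqP; rewrite -subr_eq0 -opprD -mulr2n -mulr_natl h2 oppr0.
have -> : [set e : Z | e ^+ 2 == 1] = [set e in [:: 1; -1; 1 + h; -1 + h]].
  apply/setP=> e; rewrite inE [RHS]inE; apply/eqP/idP; first exact: sqrt1_sub.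
  have s1 : (1 + h) ^+ 2 = 1.
    have -> : (1 + h) ^+ 2 = 1 + 2%:R * h + h ^+ 2 by ring.
    by rewrite h2 hh !addr0.
  rewrite !inE => /or4P[] /eqP->; rewrite ?sqrrN ?expr1n //.
  by rewrite -sqrrN opprD opprK hN.
rewrite cardsE; apply/card_uniqP; rewrite /= !inE !negb_or !andbT.
have neq (x y d : Z) : d != 0 -> x - y = d -> x != y.
  by move=> d0 xy; rewrite -subr_eq0 xy.
have h2n : 2%:R - h != 0 by rewrite subr_eq0 eq_sym.
rewrite (neq 1 (-1) _ two0) ?(neq 1 (1 + h) _ h0) ?(neq 1 (-1 + h) _ h2n)
  ?(neq (-1) (1 + h) (h - 2%:R)) ?(neq (-1) (-1 + h) _ h0)
  ?(neq (1 + h) (-1 + h) _ two0) ?subr_eq0 //; try ring.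
- by rewrite -[h in RHS]hN; ring.
- by rewrite -[h in RHS]hN; ring.
- by rewrite -[h in RHS]hN; ring.
Qed.

Lemma pq_Z4 : pq 'Z_4 = 4.
Proof.
have /= := @pq_cyclic_two 2 isT; rewrite -[pq _]/(pq 'Z_4) => ->.
have -> : [set e : 'Z_(2 ^ 2) | e ^+ 2 == 1] = [set 1; -1].
  by apply/setP => -[[|[|[|[|]]]] ?] //; rewrite !inE.
by rewrite cards2.
Qed.

Lemma pq_Z2 : pq 'Z_2 = 1%N.
Proof.
have /= := @pq_cyclic_two 1 isT; rewrite -[pq _]/(pq 'Z_2) => ->.
have -> : [set e : 'Z_(2 ^ 1) | e ^+ 2 == 1] = [set 1].
  by apply/setP => -[[|[|]] ?] //; rewrite !inE.
by rewrite cards1.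
Qed.

(** * Matrices of order 2 by their entries *)

Section Matrix2.

Variable F : fieldType.
Implicit Types (A B : 'M[F]_2) (a b c d : F).

(** With explicit entries, matrix identities become four identities in F that
    ring can check. *)
Definition mx2 a b c d : 'M[F]_2 :=
  \matrix_(i, j) if i == 0 then if j == 0 then a else b
                 else if j == 0 then c else d.

Lemma mx2_eta A : A = mx2 (A 0 0) (A 0 1) (A 1 0) (A 1 1).
Proof.
apply/matrixP=> i j; rewrite mxE.
by case: i => [[|[|//]] ?]; case: j => [[|[|//]] ?]; congr (A _ _); apply: val_inj.
Qed.

Lemma mx2P A : exists a b c d, A = mx2 a b c d.
Proof. by exists (A 0 0), (A 0 1), (A 1 0), (A 1 1); apply: mx2_eta. Qed.

Lemma mx2_inj a b c d a' b' c' d' : mx2 a b c d = mx2 a' b' c' d' ->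
  [/\ a = a', b = b', c = c' & d = d'].
Proof.
by move=> /matrixP E; move: (E 0 0) (E 0 1) (E 1 0) (E 1 1); rewrite !mxE.
Qed.

Lemma mx2M a b c d a' b' c' d' :
  mx2 a b c d * mx2 a' b' c' d' =
  mx2 (a * a' + b * c') (a * b' + b * d') (c * a' + d * c') (c * b' + d * d').
Proof.
apply/matrixP=> i j; rewrite !mxE !big_ord_recl big_ord0 addr0 !mxE /=.
by case: (i == 0); case: (j == 0).
Qed.

Lemma mx2D a b c d a' b' c' d' :
  mx2 a b c d + mx2 a' b' c' d' = mx2 (a + a') (b + b') (c + c') (d + d').
Proof. by apply/matrixP=> i j; rewrite !mxE; case: (i == 0); case: (j == 0). Qed.

Lemma mx2N a b c d : - mx2 a b c d = mx2 (- a) (- b) (- c) (- d).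
Proof. by apply/matrixP=> i j; rewrite !mxE; case: (i == 0); case: (j == 0). Qed.

Lemma mx2_scalar a : a%:M = mx2 a 0 0 a.
Proof.
by apply/matrixP=> i j; rewrite !mxE; case: i => [[|[|//]] ?]; case: j => [[|[|//]] ?].
Qed.

Lemma mx2_0 : 0 = mx2 0 0 0 0.
Proof. by rewrite -mx2_scalar; apply/esym/rmorph0. Qed.

Lemma mx2_1 : 1 = mx2 1 0 0 1.
Proof. by rewrite -mx2_scalar. Qed.

Definition mx2E := (mx2M, mx2D, mx2N, mx2_scalar, mx2_0, mx2_1).

Lemma det_mx2 a b c d : \det (mx2 a b c d) = a * d - b * c.
Proof.
rewrite (expand_det_row _ 0) !big_ord_recl big_ord0 /cofactor !det_mx11 !mxE /=.
by rewrite addr0 expr0 expr1 mul1r mulN1r mulrN.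
Qed.

Lemma mxtrace_mx2 a b c d : \tr (mx2 a b c d) = a + d.
Proof. by rewrite /mxtrace !big_ord_recl big_ord0 addr0 !mxE. Qed.

Lemma unit_mx2 a b c d : (mx2 a b c d \is a GRing.unit) = (a * d - b * c != 0).
Proof. by rewrite -[LHS]/(_ \in unitmx) unitmxE det_mx2 unitfE. Qed.

End Matrix2.

(** * Eliminating the constant term over the plane *)

Section Plane.

Variable F : finFieldType.
Hypothesis F_prime : forall x : F, exists n : nat, x = n%:R.

Local Notation V := (F * F)%type.
Local Notation M2 := 'M[F]_2.

Definition mx2_app (A : M2) (v : V) : V :=
  (A 0 0 * v.1 + A 0 1 * v.2, A 1 0 * v.1 + A 1 1 * v.2).

Lemma mx2_appE a b c d x y :
  mx2_app (mx2 a b c d) (x, y) = (a * x + b * y, c * x + d * y).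
Proof. by rewrite /mx2_app !mxE. Qed.

Lemma addVE (x y x' y' : F) : (x, y) + (x', y') = (x + x', y + y') :> V.
Proof. by []. Qed.

(** Additive maps of the plane are linear because every scalar of a prime field
    is a sum of ones. *)
Lemma mx2_full_action : full_action mx2_app.
Proof.
split.
- by move=> A [x y] [x' y']; rewrite [A]mx2_eta addVE !mx2_appE addVE; congr pair; ring.
- move=> A B [x y]; rewrite [A]mx2_eta [B]mx2_eta mx2E !mx2_appE addVE; congr pair; ring.
- by move=> A B [x y]; rewrite [A]mx2_eta [B]mx2_eta mx2E !mx2_appE ?mxE /=; congr pair; ring.
- by move=> [x y]; rewrite mx2E mx2_appE; congr pair; ring.
- move=> A B AB; have := AB (1, 0); have := AB (0, 1).
  rewrite [A]mx2_eta [B]mx2_eta !mx2_appE !mulr0 !mulr1 !add0r !addr0.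
  by move=> [-> ->] [-> ->].
move=> f fD; exists (mx2 (f (1, 0)).1 (f (0, 1)).1 (f (1, 0)).2 (f (0, 1)).2) => -[x y].
have f0 : f (0, 0) = 0 by apply: (addrI (f 0)); rewrite -fD !addr0.
have [m ->] := F_prime x; have [n ->] := F_prime y; rewrite mx2_appE.
have fx : f (m%:R, 0) = (m%:R * (f (1, 0)).1, m%:R * (f (1, 0)).2).
  elim: m => [|m IH]; first by rewrite f0 !mul0r.
  have -> : (m.+1%:R, 0) = (m%:R, 0) + (1, 0) :> V by rewrite addVE addr0 mulrSr.
  by rewrite fD IH [f (1, 0)]surjective_pairing addVE !mulrSr; congr pair; rewrite /=; ring.
have fy : f (0, n%:R) = (n%:R * (f (0, 1)).1, n%:R * (f (0, 1)).2).
  elim: n => [|n IH]; first by rewrite f0 !mul0r.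
  have -> : (0, n.+1%:R) = (0, n%:R) + (0, 1) :> V by rewrite addVE addr0 mulrSr.
  by rewrite fD IH [f (0, 1)]surjective_pairing addVE !mulrSr; congr pair; rewrite /=; ring.
have -> : (m%:R, n%:R) = (m%:R, 0) + (0, n%:R) :> V by rewrite addVE addr0 add0r.
by rewrite fD fx fy addVE; congr pair; ring.
Qed.

Definition conj_pair : rel (M2 * M2) := fun x y =>
  [exists u, [&& u \is a GRing.unit, u * x.1 == y.1 * u & u * x.2 == y.2 * u]].

Lemma conj_pairP x y :
  reflect (exists u, [/\ u \is a GRing.unit, u * x.1 = y.1 * u
                       & u * x.2 = y.2 * u]) (conj_pair x y).
Proof.
apply: (iffP existsP) => -[u]; last first.
  by case=> Uu u1 u2; exists u; rewrite Uu u1 u2 !eqxx.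
by case/and3P => Uu /eqP u1 /eqP u2; exists u.
Qed.

Lemma conj_pair_equivalence : equivalence_rel conj_pair.
Proof.
have rfl x : conj_pair x x.
  by apply/conj_pairP; exists 1; rewrite unitr1 !mul1r !mulr1.
have sym x y : conj_pair x y -> conj_pair y x.
  case/conj_pairP=> u [Uu u1 u2]; apply/conj_pairP; exists u^-1.
  by rewrite unitrV Uu; split=> //; apply: (mulrI Uu); apply: (mulIr Uu);
    rewrite mulVKr // !mulrA ?u1 ?u2 mulrK // mulrV // mul1r.
have trs x y z : conj_pair x y -> conj_pair y z -> conj_pair x z.
  case/conj_pairP=> u [Uu u1 u2] /conj_pairP[v [Uv v1 v2]].
  apply/conj_pairP; exists (v * u).
  by rewrite unitrMl // Uv -!mulrA u1 u2 !mulrA v1 v2.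
move=> x y z; split=> // xy; apply/idP/idP; apply: trs => //; exact: sym.
Qed.

Lemma conj_pair_refl (x : M2 * M2) : conj_pair x x.
Proof. by have [] := conj_pair_equivalence x x x. Qed.

Lemma conj_pair_trans (x y z : M2 * M2) :
  conj_pair x y -> conj_pair y z -> conj_pair x z.
Proof. by have [_ H] := conj_pair_equivalence x y z; move/H ->. Qed.

Lemma conj_pair_sym (x y : M2 * M2) : conj_pair x y -> conj_pair y x.
Proof. by move=> xy; have [_ /(_ xy) <-] := conj_pair_equivalence x y x; apply: conj_pair_refl. Qed.

Definition paramedial_pairs : {set M2 * M2} :=
  [set x | [&& x.1 \is a GRing.unit, x.2 \is a GRing.unit & x.1 ^+ 2 == x.2 ^+ 2]].

Let appF := mx2_full_action.

Lemma mx2_app_scale (l : F) v : mx2_app l%:M v = (l * v.1, l * v.2).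
Proof. by case: v => x y; rewrite mx2E mx2_appE !mul0r addr0 add0r. Qed.

Lemma transitive_nonzero (v w : V) : v != 0 -> w != 0 ->
  exists2 u : M2, u \is a GRing.unit & mx2_app u v = w.
Proof.
have col z : z != 0 -> exists2 P : M2, P \is a GRing.unit & mx2_app P (1, 0) = z.
  case: z => x y; rewrite xpair_eqE negb_and.
  have [-> /= y0 | x0 _] := eqVneq x 0.
    exists (mx2 0 1 y 0); last by rewrite mx2_appE; congr pair; ring.
    by rewrite unit_mx2 mul0r mul1r sub0r oppr_eq0.
  exists (mx2 x 0 y 1); last by rewrite mx2_appE; congr pair; ring.
  by rewrite unit_mx2 mul0r mulr1 subr0.
move=> /col[P UP <-] /col[Q UQ <-]; exists (Q * P^-1); first by rewrite unitrMl ?unitrV.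
by rewrite -(full_appM appF) mulrVK.
Qed.

Lemma mx2_appZ N (l : F) v :
  mx2_app N (l * v.1, l * v.2) = (l * (mx2_app N v).1, l * (mx2_app N v).2).
Proof. by rewrite /mx2_app /=; congr pair; ring. Qed.

Lemma colinearP (x y z t : F) : (x, y) != 0 :> V -> x * t - y * z = 0 ->
  exists l, (z, t) = (l * x, l * y).
Proof.
rewrite xpair_eqE negb_and => /orP[] n0 /eqP; rewrite subr_eq0 => /eqP D0.
  by exists (z / x); rewrite divfK // mulrAC [z * y]mulrC -D0 mulrAC mulfV ?mul1r.
by exists (t / y); rewrite divfK // mulrAC [t * x]mulrC D0 mulrAC mulfV ?mul1r.
Qed.

(** As v is off its image, the non-zero matrix N has a line for image; two
    vectors off this line agree up to a non-zero scalar modulo the line. *)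
Lemma singular_coset (N : M2) (v w : V) : N != 0 ->
    (forall d, v != mx2_app N d) -> (forall d, w != mx2_app N d) ->
  exists (l : F) (d : V), l != 0 /\ w = mx2_app l%:M v + mx2_app N d.
Proof.
move=> N0 vN wN.
have [e e0] : exists e, mx2_app N e != 0.
  apply/existsP; apply: contraNT N0 => /existsPn H; apply/eqP.
  apply: (full_app_inj appF) => z; rewrite (app_0l appF).
  by apply/eqP; rewrite -[_ == _]negbK.
case Ee : (mx2_app N e) e0 => [x y] e0.
have indep z : (forall d, z != mx2_app N d) -> x * z.2 - y * z.1 != 0.
  case: z => z t zN; apply/eqP => /(colinearP e0)[l zt].
  by have := zN (l * e.1, l * e.2); rewrite mx2_appZ Ee zt eqxx.
have Dv := indep v vN; have Dw := indep w wN.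
exists ((x * w.2 - y * w.1) / (x * v.2 - y * v.1)).
pose m := (w.1 * v.2 - w.2 * v.1) / (x * v.2 - y * v.1).
exists (m * e.1, m * e.2); split; first by rewrite mulf_neq0 ?invr_eq0.
rewrite mx2_app_scale mx2_appZ Ee /m; case: v w {vN wN Dw m} Dv => [v1 v2] [w1 w2] /= Dv.
by rewrite addVE; congr pair; field.
Qed.

Lemma mx2_app_surj_unit (N : M2) : (forall v, exists d, v = mx2_app N d) ->
  N \is a GRing.unit.
Proof.
move=> Ns; apply: (app_bij_unit appF).
have sN : [set: V] \subset mx2_app N @: [set: V].
  by apply/subsetP=> v _; have [d ->] := Ns v; apply: imset_f; rewrite inE.
have iN : {in [set: V] &, injective (mx2_app N)}.
  apply/imset_injP/eqP; move: (subset_leq_card sN) (leq_imset_card (mx2_app N) [set: V]).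
  by move=> ? ?; apply/eqP; rewrite eqn_leq; apply/andP.
by apply: injF_bij => v w /iN; apply; rewrite inE.
Qed.

Definition singular_pairs : {set M2 * M2} :=
  [set x in paramedial_pairs | 1 - x.1 - x.2 \isn't a GRing.unit].

(** Only the coset of the constant c modulo the image of N = 1 - A - B matters.
    The constants in the image are all equivalent to 0, which gives one class
    for each class of pairs. Constants off the image exist only if N is
    singular, and then they are all equivalent. Indeed, if N has rank 1, this
    follows from singular_coset, as scalars commute with A and B. If N = 0,
    then B = 1 - A, and A ^ 2 = B ^ 2 forces 2 A = 1, so that A and B are
    central and the whole linear group, transitive on non-zero vectors, acts
    on the constants. *)
Theorem pq_plane :
  pq V = (nclasses conj_pair paramedial_pairs + nclasses conj_pair singular_pairs)%N.
Proof.
rewrite (pq_forms appF).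
have isoP := form_isoP appF.
pose Q (x : M2 * M2 * V) := [exists d, x.2 == mx2_app (1 - x.1.1 - x.1.2) d].
have appB (N : M2) d : mx2_app (1 - N) d = d - mx2_app N d.
  by rewrite (full_appDl appF) (full_app1 appF) (app_Nl appF).
have uN (u : M2) (x y : M2 * M2) : u * x.1 = y.1 * u -> u * x.2 = y.2 * u ->
    u * (1 - x.1 - x.2) = (1 - y.1 - y.2) * u.
  by move=> u1 u2; rewrite !mulrBr mulr1 u1 u2 !mulrBl mul1r.
have Qinv x y : x \in forms _ _ -> y \in forms _ _ ->
    form_iso mx2_app x y -> Q x -> Q y.
  move=> Fx Fy /(isoP _ _ Fx Fy)[u [d [Uu u1 u2 yE]]] /existsP[e /eqP xE].
  apply/existsP; exists (mx2_app u e + d); apply/eqP; rewrite yE xE.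
  rewrite (full_appDr appF) -!(full_appM appF) -addrA -appB opprD addrA; congr (_ + _).
  by rewrite (uN _ _ _ u1 u2).
have eqE := @form_iso_equivalence _ _ mx2_app.
rewrite (nclasses_split eqE (Q := Q)) => [|x y Fx Fy xy]; last first.
  have yx : form_iso mx2_app y x by have [xx /(_ xy) <-] := eqE x y x.
  by apply/idP/idP; [exact: Qinv Fx Fy xy | exact: Qinv Fy Fx yx].
have FE x : (x \in forms _ _) = (x.1 \in paramedial_pairs) by rewrite !inE.
congr (_ + _)%N; apply: (nclasses_reduce (f := fst)) => //;
  try exact: conj_pair_equivalence.
- by move=> x; rewrite inE FE => /andP[].
- move=> x y /setIdP[Fx /existsP[e /eqP xE]] /setIdP[Fy /existsP[e' /eqP yE]].
  apply/(isoP _ _ Fx Fy)/conj_pairP => [[u [d [Uu u1 u2 _]]] | [u [Uu u1 u2]]]; exists u => //.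
  exists (e' - mx2_app u e); split=> //.
  rewrite -addrA -appB opprD addrA xE yE -(full_appM appF) (uN _ _ _ u1 u2).
  by rewrite (full_appM appF) -(full_appDr appF) [mx2_app u e + _]addrC subrK.
- move=> y Py; exists (y, 0); last by have [] := conj_pair_equivalence y y y.
  by rewrite inE FE Py; apply/existsP; exists 0; rewrite (app_0r appF).
- move=> x /setIdP[]; rewrite FE => Px nQ; apply/setIdP; split=> //.
  apply: contra nQ => UN; apply/existsP; exists (mx2_app (1 - x.1.1 - x.1.2)^-1 x.2).
  by rewrite -(full_appM appF) mulrV // (full_app1 appF).
- move=> x y /setIdP[Fx nQx] /setIdP[Fy nQy].
  apply/(isoP _ _ Fx Fy)/conj_pairP => [[u [d [Uu u1 u2 _]]] | [u [Uu u1 u2]]]; first by exists u.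
  have nQux : ~~ Q (y.1, mx2_app u x.2).
    apply: contra nQx => /existsP[d /eqP /= dE]; apply/existsP.
    exists (mx2_app u^-1 d); apply/eqP.
    apply: (can_inj (app_K appF Uu)); rewrite dE -!(full_appM appF).
    by rewrite ?mulrA (uN _ _ _ u1 u2) mulrK.
  have [N0 | N0] := eqVneq (1 - y.1.1 - y.1.2) 0.
    have nz (c : V) : ~~ Q (y.1, c) -> c != 0.
      by apply: contra => /eqP ->; apply/existsP; exists 0; rewrite (app_0r appF).
    have [v Uv vE] := transitive_nonzero (nz _ nQux) (nz y.2 nQy).
    have bE : y.1.2 = 1 - y.1.1 by apply/esym/eqP; rewrite -subr_eq0 N0.
    (* A is the inverse of 2, hence central. *)
    have va : GRing.comm v y.1.1.
      have /and3P[_ _ /eqP] : [&& y.1.1 \is a GRing.unit, y.1.2 \is a GRing.unit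
             & y.1.1 ^+ 2 == y.1.2 ^+ 2] by move: Fy; rewrite inE.
      rewrite bE expr2 [RHS]expr2 mulrBl mul1r mulrBr mulr1 opprB addrA addrAC => ab.
      have a2 : 2%:R * y.1.1 = 1.
        rewrite mulr_natl; apply/esym/eqP; rewrite -subr_eq0 mulr2n opprD addrA.
        by apply/eqP/(addIr (y.1.1 * y.1.1)); rewrite -ab add0r.
      have U2 : 2%:R \is a @GRing.unit M2.
        by apply/unitrP; exists y.1.1; rewrite a2 mulr_natr -mulr_natl.
      rewrite -[y.1.1](mulKr U2) a2 mulr1; apply: commrV; exact: commr_nat.
    exists (v * u), 0; split.
    + by rewrite unitrMl.
    + by rewrite -mulrA u1 mulrA va mulrA.
    + by rewrite -mulrA u2 mulrA bE mulrBr mulr1 va -{1}[v]mul1r -mulrBl -mulrA.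
    by rewrite (app_0r appF) subr0 addr0 (full_appM appF) vE.
  have nI c : ~~ Q (y.1, c) -> forall d, c != mx2_app (1 - y.1.1 - y.1.2) d.
    by move/existsPn.
  have [l [d [l0 yE]]] := singular_coset N0 (nI _ nQux) (nI y.2 nQy).
  have lC (A B : M2) : l%:M * (A * B) = A * (l%:M * B).
    by rewrite !mulrA; congr (_ * _); apply/esym/scalar_mxC.
  exists (l%:M * u), d; split.
  - by rewrite unitrMl // -[_ \is a _]/(_ \in unitmx) unitmxE det_scalar unitfE expf_neq0.
  - by rewrite -mulrA u1 lC.
  - by rewrite -mulrA u2 lC.
  by rewrite yE (full_appM appF) -[RHS]addrA -appB opprD addrA.
move=> y; rewrite inE => /andP[Py nU].
have [c cN] : exists c, forall d, c != mx2_app (1 - y.1 - y.2) d.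
  have : ~~ [forall c, exists d, c == mx2_app (1 - y.1 - y.2) d].
    apply: contra nU => /forallP H; apply: mx2_app_surj_unit => v.
    by have /existsP[d /eqP ->] := H v; exists d.
  by case/forallPn=> c /existsPn ?; exists c.
exists (y, c); last by have [] := conj_pair_equivalence y y y.
by rewrite inE FE Py; apply/existsPn.
Qed.

End Plane.

(** * Conjugacy of matrices of order 2 *)

Section Companion.

Variable F : fieldType.
Implicit Types (S : 'M[F]_2).

Definition companion (t d : F) : 'M[F]_2 := mx2 0 (- d) 1 t.

(** A non-scalar S has a cyclic vector v among e1, e2 and e1 + e2; the columns of
    u are v and S v. *)
Lemma companion_conj S : ~~ is_scalar_mx S ->
  exists2 u, u \is a GRing.unit & u * companion (\tr S) (\det S) = S * u.
Proof.
rewrite /companion; have [a [b [c [d ->]]]] := mx2P S; rewrite det_mx2 mxtrace_mx2 => nS.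
have [c0 | c0] := eqVneq c 0; last first.
  exists (mx2 1 a 0 c); first by rewrite unit_mx2 mul1r mulr0 subr0.
  by rewrite !mx2M; congr mx2; ring.
have [b0 | b0] := eqVneq b 0; last first.
  exists (mx2 0 b 1 d); first by rewrite unit_mx2 mul0r mulr1 sub0r oppr_eq0.
  by rewrite !mx2M; congr mx2; ring.
have ad : d - a != 0.
  apply: contraNneq nS => /subr0_eq da; apply/is_scalar_mxP; exists a.
  by rewrite mx2_scalar b0 c0 da.
exists (mx2 1 a 1 d); first by rewrite unit_mx2 mul1r mulr1.
by rewrite !mx2M b0 c0; congr mx2; ring.
Qed.

Lemma conj_det (u A B : 'M[F]_2) : u \is a GRing.unit -> u * A = B * u ->
  \det A = \det B.
Proof.
move=> Uu /(congr1 determinant); rewrite !det_mulmx [RHS]mulrC; apply: mulfI.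
by rewrite -unitfE -unitmxE.
Qed.

Lemma conj_tr (u A B : 'M[F]_2) : u \is a GRing.unit -> u * A = B * u ->
  \tr A = \tr B.
Proof.
move=> Uu uAB; rewrite -[A](mulKr Uu) uAB -[LHS]/(\tr (u^-1 *m (B * u))) mxtrace_mulC.
by rewrite -[_ *m _]/(B * u * u^-1) mulrK.
Qed.

Lemma conj_scalar (u A B : 'M[F]_2) : u \is a GRing.unit -> u * A = B * u ->
  is_scalar_mx A -> is_scalar_mx B.
Proof.
move=> Uu uAB /is_scalar_mxP[a Aa]; apply/is_scalar_mxP; exists a.
apply: (mulIr Uu); rewrite -uAB Aa; exact: scalar_mxC.
Qed.

Lemma scalar_unit2 (a : F) : (a%:M : 'M[F]_2) \is a GRing.unit = (a != 0).
Proof. by rewrite mx2_scalar unit_mx2 mulr0 subr0 mulf_eq0 orbb. Qed.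

End Companion.

(** * Pairs with equal squares in odd characteristic *)

Section Anticommuting.

Variable F : finFieldType.
Hypothesis two_neq0 : 2%:R != 0 :> F.

Local Notation M2 := 'M[F]_2.

Lemma mx2_sum_diff_anticomm (A B : M2) :
  (A + B) * (A - B) + (A - B) * (A + B) = 2%:R * (A ^+ 2 - B ^+ 2).
Proof.
have [a [b [c [d ->]]]] := mx2P A; have [x [y [z [t ->]]]] := mx2P B.
by rewrite !expr2 mulr_natl mulr2n !mx2E; congr mx2; ring.
Qed.

Lemma mx2_sum_diff_sqr (A B : M2) :
  (A + B) ^+ 2 + (A - B) ^+ 2 = 2%:R * (A ^+ 2 + B ^+ 2).
Proof.
have [a [b [c [d ->]]]] := mx2P A; have [x [y [z [t ->]]]] := mx2P B.
by rewrite !expr2 mulr_natl mulr2n !mx2E; congr mx2; ring.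
Qed.

(** These are the pairs (A + B, A - B) with A ^ 2 = B ^ 2 invertible: anticommuting
    S and D satisfy (S + D) ^ 2 = (S - D) ^ 2 = S ^ 2 + D ^ 2. *)
Definition anticommuting : {set M2 * M2} :=
  [set x | (x.1 * x.2 == - (x.2 * x.1))
           && (x.1 ^+ 2 + x.2 ^+ 2 \is a GRing.unit)].

Let two_unit : 2%:R \is a @GRing.unit M2.
Proof.
rewrite mulr2n !mx2E unit_mx2 !addr0 mulr0 subr0.
by rewrite -mulr2n mulf_neq0.
Qed.

(** The change of variables S = A + B, D = A - B commutes with conjugation and is
    invertible as 2 is. It turns 1 - A - B into 1 - S, so that the singular
    pairs are recognized on S alone. *)
Lemma nclasses_anticommuting (Q : pred M2) :
  nclasses (@conj_pair F) [set x in paramedial_pairs F | Q (x.1 + x.2)]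
  = nclasses (@conj_pair F) [set x in anticommuting | Q x.1].
Proof.
have mx2K (A B : M2) : 2%:R * A = 2%:R * B -> A = B by apply: mulrI.
have nat_comm (A B : M2) : 2%:R * (A * B) = A * (2%:R * B).
  by rewrite !mulrA -[2%:R * A]commr_nat.
have dbl (A B : M2) : (A + B) + (A - B) = 2%:R * A.
  by rewrite addrACA subrr addr0 mulr_natl mulr2n.
have dbl' (A B : M2) : (A + B) - (A - B) = 2%:R * B.
  by rewrite opprB addrC addrA subrK mulr_natl mulr2n.
apply: (nclasses_reduce (f := fun x => (x.1 + x.2, x.1 - x.2)));
  try exact: conj_pair_equivalence.
- move=> x; rewrite !inE /= => /andP[/and3P[Ua Ub /eqP ab] ->]; rewrite andbT.
  apply/andP; split.
    by rewrite -addr_eq0 mx2_sum_diff_anticomm ab subrr mulr0.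
  by rewrite mx2_sum_diff_sqr -ab -[_ + _]mulr2n -[_ ^+ 2 *+ 2]mulr_natl !unitrMr ?unitrX.
- move=> x y _ _; apply/conj_pairP/conj_pairP => -[u [Uu]] /= u1 u2; exists u; split=> //=.
  + by rewrite mulrDr mulrDl u1 u2.
  + by rewrite mulrBr mulrBl u1 u2.
  + apply: mx2K; rewrite nat_comm [RHS]mulrA -(dbl x.1 x.2) -(dbl y.1 y.2).
    by rewrite mulrDr mulrDl u1 u2.
  + apply: mx2K; rewrite nat_comm [RHS]mulrA -(dbl' x.1 x.2) -(dbl' y.1 y.2).
    by rewrite mulrBr mulrBl u1 u2.
move=> [S D]; rewrite inE => /andP[] /=; rewrite inE /= => /andP[SD U2] QS.
have halfK (A : M2) : 2%:R * (2%:R^-1 * A) = A by rewrite mulVKr.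
pose A := 2%:R^-1 * (S + D); pose B := 2%:R^-1 * (S - D).
have AB : A + B = S by apply: mx2K; rewrite mulrDr !halfK dbl.
have AB' : A - B = D by apply: mx2K; rewrite mulrBr !halfK dbl'.
exists (A, B); last by rewrite /= AB AB'; apply: conj_pair_refl.
have ab : A ^+ 2 = B ^+ 2.
  apply: subr0_eq; apply: mx2K; rewrite mulr0 -mx2_sum_diff_anticomm AB AB'.
  by apply/eqP; rewrite addr_eq0.
have UA : A \is a GRing.unit.
  rewrite -(@unitrX_pos _ A 2) //.
  have e2 : A ^+ 2 + A ^+ 2 = 2%:R * A ^+ 2 by rewrite mulr_natl mulr2n.
  move: U2; rewrite -AB -AB' mx2_sum_diff_sqr -ab e2.
  by rewrite (unitrMr _ two_unit) (unitrMr _ two_unit).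
by rewrite !inE /= UA AB QS ab eqxx -(@unitrX_pos _ B 2) // -ab unitrX.
Qed.

Lemma anticommuting_conj x y :
  conj_pair x y -> x \in anticommuting -> y \in anticommuting.
Proof.
case/conj_pairP=> u [Uu u1 u2]; rewrite !inE => /andP[/eqP SD US].
have U2 : u * (x.1 ^+ 2 + x.2 ^+ 2) = (y.1 ^+ 2 + y.2 ^+ 2) * u.
  by rewrite mulrDr mulrDl !expr2 !mulrA u1 u2 -!mulrA u1 u2.
apply/andP; split; last by rewrite -(unitrMl _ Uu) -U2 unitrMr.
apply/eqP/(mulIr Uu); rewrite mulNr -!mulrA -u1 -u2 !mulrA -u1 -u2 -!mulrA SD.
by rewrite mulrN.
Qed.

Lemma anticommuting_sym x : (x \in anticommuting) = ((x.2, x.1) \in anticommuting).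
Proof. by rewrite !inE /= addrC eq_sym eqr_oppLR. Qed.

Lemma conj_swap (x y : M2 * M2) : conj_pair (x.2, x.1) (y.2, y.1) = conj_pair x y.
Proof.
by apply/conj_pairP/conj_pairP => -[u [Uu u1 u2]]; exists u.
Qed.

Lemma anticommuting_companion x : x \in anticommuting -> ~~ is_scalar_mx x.1 ->
  exists D, (companion (\tr x.1) (\det x.1), D) \in anticommuting
            /\ conj_pair (companion (\tr x.1) (\det x.1), D) x.
Proof.
move=> Ax /companion_conj[u Uu uS]; exists (u^-1 * x.2 * u).
have cx : conj_pair (companion (\tr x.1) (\det x.1), u^-1 * x.2 * u) x.
  by apply/conj_pairP; exists u; rewrite /= !mulrA mulrV // mul1r.
split=> //; apply: anticommuting_conj Ax.
exact: conj_pair_sym.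
Qed.

(** The entries of S D + D S = 0, read as a linear system for D. The products
    t w and t (d z) appear in it with a factor 2. *)
Lemma companion_anticommP (t d x y z w : F) :
  (companion t d, mx2 x y z w) \in anticommuting ->
  [/\ y = d * z, x + w = - t * z, t * w = 0, t * (d * z) = 0
    & companion t d ^+ 2 + mx2 x y z w ^+ 2 \is a GRing.unit].
Proof.
rewrite inE /= /companion => /andP[/eqP E ->].
move: E; rewrite !mx2M mx2N => /mx2_inj[e1 e2 e3 e4].
have two0 (r : F) : 2%:R * r = 0 -> r = 0.
  by move/eqP; rewrite mulf_eq0 (negPf two_neq0) => /eqP.
have lin (L R : F) : L - R = 0 -> L = R by move/subr0_eq.
have ey : y = d * z.
  apply: lin; transitivity (0 * x + - d * z - - (x * 0 + y * 1)); first by ring.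
  by rewrite e1 subrr.
have ex : x + w = - t * z.
  apply: lin; transitivity (1 * x + t * z - - (z * 0 + w * 1)); first by ring.
  by rewrite e3 subrr.
have tw : t * w = 0.
  apply: two0; transitivity (1 * y + t * w - - (z * - d + w * t) - (y - d * z)); first by ring.
  by rewrite e4 ey !subrr.
split=> //; apply: two0.
transitivity (0 * y + - d * w - - (x * - d + y * t) + d * (x + w - (- t * z)) - t * (y - d * z)).
  by ring.
by rewrite e2 ex ey !subrr !mulr0 subr0 addr0.
Qed.

End Anticommuting.

Section Leaves.

Variable F : finFieldType.
Hypothesis two_neq0 : 2%:R != 0 :> F.

Local Notation M2 := 'M[F]_2.
Local Notation AC := (anticommuting F).

Lemma conj_pair_inv0 (x y : M2 * M2) : conj_pair x y -> x.1 == 0 -> y.1 == 0.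
Proof.
case/conj_pairP=> u [Uu u1 _] /eqP x0; apply/eqP/(mulIr Uu).
by rewrite -u1 x0 mulr0 mul0r.
Qed.

Lemma conj_pair_scalar (x y : M2 * M2) :
  conj_pair x y -> is_scalar_mx x.1 -> is_scalar_mx y.1.
Proof. by case/conj_pairP=> u [Uu u1 _]; apply: conj_scalar u1. Qed.

Lemma conj_pair_tr (x y : M2 * M2) : conj_pair x y -> \tr x.1 = \tr y.1.
Proof. by case/conj_pairP=> u [Uu u1 _]; apply: conj_tr u1. Qed.

Lemma conj_pair_det (x y : M2 * M2) : conj_pair x y -> \det x.1 = \det y.1.
Proof. by case/conj_pairP=> u [Uu u1 _]; apply: conj_det u1. Qed.

Lemma conj_pair_tr2 (x y : M2 * M2) : conj_pair x y -> \tr x.2 = \tr y.2.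
Proof. by rewrite -conj_swap => /conj_pair_tr. Qed.

Lemma conj_pair_det2 (x y : M2 * M2) : conj_pair x y -> \det x.2 = \det y.2.
Proof. by rewrite -conj_swap => /conj_pair_det. Qed.

Lemma mx2_eq0 (a b c d : F) :
  (mx2 a b c d == 0) = [&& a == 0, b == 0, c == 0 & d == 0].
Proof.
apply/eqP/and4P => [|[/eqP-> /eqP-> /eqP-> /eqP->]]; last by rewrite mx2_0.
by rewrite mx2_0 => /mx2_inj[-> -> -> ->].
Qed.

Lemma pair_with_zeroP (x : M2 * M2) : x \in AC -> x.2 == 0 ->
  x.1 \is a GRing.unit.
Proof.
rewrite inE => /andP[_ U] /eqP x0; move: U.
by rewrite x0 expr0n addr0 unitrX_pos.
Qed.

Lemma zero_in_AC (A : M2) : A \is a GRing.unit -> (A, 0) \in AC.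
Proof.
by move=> UA; rewrite inE /= mulr0 mul0r oppr0 eqxx expr0n addr0 unitrX.
Qed.

Lemma scalar_pair_form (x : M2 * M2) : x \in AC -> x.2 == 0 -> is_scalar_mx x.1 ->
  exists2 a : F, a != 0 & conj_pair (a%:M, 0) x.
Proof.
case: x => S D Ax /= /eqP D0 /is_scalar_mxP[a aS]; exists a.
  have := pair_with_zeroP Ax; rewrite /= D0 aS scalar_unit2; exact.
by rewrite aS D0 conj_pair_refl.
Qed.

Lemma nonscalar_pair_form (x : M2 * M2) : x \in AC -> x.2 == 0 ->
    ~~ is_scalar_mx x.1 ->
  \det x.1 != 0 /\ conj_pair (companion (\tr x.1) (\det x.1), 0) x.
Proof.
move=> Ax x2; have := pair_with_zeroP Ax x2.
rewrite -[_ \is a _]/(x.1 \in unitmx) unitmxE unitfE => Ux.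
case/companion_conj=> u Uu u1; split=> //; apply/conj_pairP; exists u.
by rewrite (eqP x2) mulr0 mul0r.
Qed.

Lemma det_companion (t d : F) : \det (companion t d) = d.
Proof. by rewrite det_mx2; ring. Qed.

Lemma tr_companion (t d : F) : \tr (companion t d) = t.
Proof. by rewrite mxtrace_mx2 add0r. Qed.

Lemma unit_companion (t d : F) : (companion t d \is a GRing.unit) = (d != 0).
Proof. by rewrite unit_mx2 mul0r mulr1 sub0r opprK. Qed.

Lemma companion_nscalar (t d : F) : ~~ is_scalar_mx (companion t d).
Proof.
apply/negP=> /is_scalar_mxP[a]; rewrite mx2_scalar => /mx2_inj[_ _ /eqP].
by rewrite oner_eq0.
Qed.

Lemma scalar_pair_inj (a b : F) : conj_pair (a%:M, 0 : M2) (b%:M, 0) -> a = b.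
Proof.
case/conj_pairP=> u [Uu /= + _]; rewrite -[_ * u]/(b%:M *m u) -scalar_mxC.
move/(mulrI Uu); rewrite !mx2_scalar => /mx2_inj[] //.
Qed.

(** If tr S is not 0, the linear system for D forces S D = 0. As D is not 0, both
    matrices have rank 1, the kernel of each being the image of the other, and
    they are diagonal in a common basis. *)
Lemma trace_pair_form (x : M2 * M2) : x \in AC -> x.2 != 0 -> \tr x.1 != 0 ->
  exists s d, [/\ s != 0, d != 0 & conj_pair (mx2 s 0 0 0, mx2 0 0 0 d) x].
Proof.
move=> Ax D0 T0; have nS : ~~ is_scalar_mx x.1.
  apply: contra D0 => /is_scalar_mxP[a aS].
  have a0 : a != 0.
    by apply: contraNneq T0 => a0; rewrite aS a0 mx2_scalar mxtrace_mx2 addr0.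
  have : x.1 * x.2 + x.2 * x.1 = 0.
    by move: Ax; rewrite inE -addr_eq0 => /andP[/eqP ->].
  have [p [q [r [s ->]]]] := mx2P x.2; rewrite aS !mx2E => /mx2_inj[e1 e2 e3 e4].
  have two_a z : a * z + z * a = 0 -> z == 0.
    move=> /eqP; rewrite mulrC -mulr2n -mulr_natl !mulf_eq0 (negPf two_neq0) (negPf a0) /=.
    by rewrite orbF.
  apply/eqP; congr mx2; apply/eqP/two_a.
  - by rewrite -[RHS]e1; ring.
  - by rewrite -[RHS]e2; ring.
  - by rewrite -[RHS]e3; ring.
  - by rewrite -[RHS]e4; ring.
have [D [AD cD]] := anticommuting_companion Ax nS.
set t := \tr x.1 in T0 AD cD *; set dt := \det x.1 in AD cD *.
have Dn0 : D != 0.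
  apply: contraNneq D0 => D0; move: cD; rewrite -conj_swap => /conj_pair_inv0 /=.
  by rewrite D0; apply.
have [p [q [r [s Dpqrs]]]] := mx2P D; rewrite Dpqrs in AD cD Dn0 *.
have [eq ep /eqP + /eqP + _] := companion_anticommP two_neq0 AD.
rewrite mulf_eq0 (negPf T0) /= => /eqP s0.
rewrite mulf_eq0 (negPf T0) /= => /eqP dr.
rewrite s0 addr0 in ep; rewrite dr in eq.
have r0 : r != 0.
  by move: Dn0; rewrite mx2_eq0 s0 eq ep eqxx mulf_eq0 oppr_eq0 (negPf T0) /= andbT andbb.
have d0 : dt = 0 by apply/eqP; move/eqP: dr; rewrite mulf_eq0 (negPf r0) orbF.
exists t, (- t * r); split=> //; first by rewrite mulf_neq0 ?oppr_eq0.
(* The columns span the image and the kernel of S. *)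
apply: conj_pair_trans cD; apply/conj_pairP; exists (mx2 0 t 1 (-1)).
split; first by rewrite unit_mx2 mul0r mulr1 sub0r oppr_eq0.
  by rewrite /= /companion d0 !mx2M; congr mx2; ring.
by rewrite /= eq ep s0 !mx2M; congr mx2; ring.
Qed.

Lemma trace_pair_AC (s d : F) : s != 0 -> d != 0 ->
  (mx2 s 0 0 0, mx2 0 0 0 d) \in AC.
Proof.
move=> s0 d0; rewrite inE /= !expr2 !mx2E unit_mx2; apply/andP; split.
  by apply/eqP; congr mx2; ring.
by rewrite !(mul0r, mulr0, addr0, add0r, subr0) !mulf_neq0.
Qed.

(** If tr S = 0, the linear system says that D is traceless and leaves two
    parameters. The last condition is that the scalar S ^ 2 + D ^ 2 is not 0. *)
Lemma traceless_form (x : M2 * M2) : x \in AC -> x.1 != 0 -> \tr x.1 = 0 ->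
  exists a c, let y := (companion 0 (\det x.1), mx2 a (\det x.1 * c) c (- a)) in
    [/\ y \in AC, conj_pair y x & - \det x.1 + (a ^+ 2 + \det x.1 * c ^+ 2) != 0].
Proof.
move=> Ax S0 T0; have nS : ~~ is_scalar_mx x.1.
  apply: contra S0 => /is_scalar_mxP[a aS]; move: T0.
  rewrite aS mxtrace_scalar -mulr_natl => /eqP; rewrite mulf_eq0 (negPf two_neq0) /=.
  by move/eqP->; rewrite rmorph0.
have [D [AD cD]] := anticommuting_companion Ax nS.
rewrite T0 in AD cD; set dt := \det x.1 in AD cD *.
have [p [q [r [s Dpqrs]]]] := mx2P D; rewrite Dpqrs in AD cD *.
have [eq ep _ _ U] := companion_anticommP two_neq0 AD.
rewrite oppr0 mul0r in ep; have es : s = - p by apply/eqP; rewrite -addr_eq0 addrC ep.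
rewrite eq es in AD cD U; exists p, r; split=> //.
apply: contraTneq U => H; rewrite /companion !expr2 !mx2E unit_mx2 negbK; apply/eqP.
transitivity ((- dt + (p ^+ 2 + dt * r ^+ 2)) ^+ 2); first by ring.
by rewrite H expr0n.
Qed.

Lemma traceless_tr2 (x : M2 * M2) : x \in AC -> x.1 != 0 -> \tr x.1 = 0 -> \tr x.2 = 0.
Proof.
move=> Ax S0 T0; have [a [c [_ cx _]]] := traceless_form Ax S0 T0.
by rewrite -(conj_pair_tr2 cx) mxtrace_mx2 subrr.
Qed.

(** When S is nilpotent, D preserves the line ker S and acts on it by the scalar
    t, and its other eigenvalue is - t. The unipotent matrix with lower entry
    c / 2 a commutes with S and diagonalizes D. *)
Lemma nilpotent_pair_form (x : M2 * M2) : x \in AC -> x.1 != 0 -> \tr x.1 = 0 ->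
    \det x.1 = 0 ->
  exists2 t, t != 0 & conj_pair (mx2 0 0 1 0, mx2 (- t) 0 0 t) x.
Proof.
move=> Ax S0 T0 d0; have [a [c []]] := traceless_form Ax S0 T0.
rewrite d0 !mul0r oppr0 add0r addr0 => _ cx a0.
have {}a0 : a != 0 by apply: contraNneq a0 => ->; rewrite expr0n.
exists (- a); first by rewrite oppr_eq0.
apply: conj_pair_trans cx; apply/conj_pairP; exists (mx2 1 0 (c / (2%:R * a)) 1).
split; first by rewrite unit_mx2 mul0r mulr1 subr0 oner_eq0.
  by rewrite /= /companion !mx2M; congr mx2; ring.
by rewrite /= !mx2M; congr mx2; field; rewrite ?a0 ?two_neq0.
Qed.

Lemma nilpotent_pair_AC (t : F) : t != 0 -> (mx2 0 0 1 0, mx2 (- t) 0 0 t) \in AC.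
Proof.
move=> t0; rewrite inE /= !expr2 !mx2E unit_mx2; apply/andP; split.
  by apply/eqP; congr mx2; ring.
by rewrite !(mul0r, mulr0, addr0, add0r, subr0) mulrNN !mulf_neq0.
Qed.

Lemma nilpotent_pair_inj (t t' : F) :
  conj_pair (mx2 0 0 1 0, mx2 (- t) 0 0 t) (mx2 0 0 1 0, mx2 (- t') 0 0 t') -> t = t'.
Proof.
case/conj_pairP=> u [Uu /= u1 u2]; have [x [y [z [w uE]]]] := mx2P u.
move: Uu u1 u2; rewrite uE !mx2M unit_mx2.
rewrite !(mul0r, mulr0, addr0, add0r, mul1r, mulr1) => Uu /mx2_inj[y0 _ wx _].
case/mx2_inj => /eqP + _ _ _; rewrite mulrN mulNr eqr_opp [_ * x]mulrC => /eqP; apply: mulfI.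
by apply: contraNneq Uu => ->; rewrite y0 !mul0r subrr.
Qed.

End Leaves.

(** * Pairs of invertible traceless matrices *)

Section QuaternionPairs.

Variable F : finFieldType.
Hypothesis two_neq0 : 2%:R != 0 :> F.

Local Notation M2 := 'M[F]_2.
Local Notation AC := (anticommuting F).

(** An element is determined by its square together with one bit, saying whether
    it is the root chosen for that square. The root 0 uses a single value of
    the bit, hence the strict inequality. *)
Lemma card_squares : (#|F| < 2 * #|[set x ^+ 2 | x : F]|)%N.
Proof.
pose r (y : F) := odflt 0 [pick x | x ^+ 2 == y].
have rP x : (x == r (x ^+ 2)) || (x == - r (x ^+ 2)).
  rewrite /r; case: pickP => [z /eqP zx | /(_ x)]; last by rewrite eqxx.
  by rewrite -eqf_sqr zx.
pose f x := (x ^+ 2, x == r (x ^+ 2)).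
have fI : injective f.
  move=> x y [xy]; rewrite xy; have := rP x; have := rP y; rewrite xy.
  move: (r _) => z; case: (x =P z) => [-> | _]; case: (y =P z) => [-> | _] //=.
  by move=> /eqP-> /eqP->.
rewrite -cardsT -(card_imset _ fI).
have -> : (2 * #|[set x ^+ 2 | x : F]| = #|setX [set x ^+ 2 | x : F] [set: bool]|)%N.
  by rewrite cardsX cardsT card_bool mulnC.
apply: proper_card; apply/properP; split.
  apply/subsetP => _ /imsetP[x _ ->]; rewrite !inE andbT.
  by apply/imsetP; exists x.
exists (0, false); first by rewrite !inE andbT; apply/imsetP; exists 0; rewrite ?expr0n.
apply/negP => /imsetP[x _ [/esym/eqP]]; rewrite expf_eq0 /= => /eqP x0.
by have := rP 0; rewrite x0 [0 == - _]eq_sym oppr_eq0 [_ == 0]eq_sym orbb => ->.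
Qed.

(** The squares and the elements d + s c ^ 2 both fill more than half of F, so
    these two sets meet. *)
Lemma norm_form_surj (s d : F) : s != 0 -> exists a c, a ^+ 2 - s * c ^+ 2 = d.
Proof.
move=> s0; pose A := [set x ^+ 2 | x : F]; pose B := [set d + s * y | y in A].
have cB : #|B| = #|A|.
  by rewrite card_imset // => x y /addrI /(mulfI s0).
have : A :&: B != set0.
  apply/eqP => AB; have := cardsUI A B; rewrite AB cards0 addn0 cB addnn -mul2n => E.
  by have := max_card [pred x in A :|: B]; rewrite E leqNgt card_squares.
case/set0Pn => z /setIP[/imsetP[a _ za] /imsetP[_ /imsetP[c _ ->] zc]].
by exists a, c; rewrite -za zc addrK.
Qed.

Definition norm_solution (s d : F) : F * F :=
  odflt (0, 0) [pick ac | ac.1 ^+ 2 - s * ac.2 ^+ 2 == d].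

Lemma norm_solutionP s d : s != 0 ->
  (norm_solution s d).1 ^+ 2 - s * (norm_solution s d).2 ^+ 2 = d.
Proof.
move=> s0; rewrite /norm_solution; case: pickP => [ac /eqP // | no].
by have [a [c acd]] := norm_form_surj d s0; have := no (a, c); rewrite acd eqxx.
Qed.

(** A representation of the quaternion algebra S ^ 2 = s, D ^ 2 = d on F[S], with
    basis 1, S: there S acts by multiplication, and D as the conjugation of F[S]
    followed by multiplication by z = a + c S, an element of norm d. *)
Definition quaternion_pair (sd : F * F) : M2 * M2 :=
  let: (a, c) := norm_solution sd.1 sd.2 in
  (companion 0 (- sd.1), mx2 a (- sd.1 * c) c (- a)).

Lemma det_quaternion_pair s d : s != 0 ->
  \det (quaternion_pair (s, d)).1 = - s /\ \det (quaternion_pair (s, d)).2 = - d.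
Proof.
move=> s0; have := norm_solutionP d s0; rewrite /quaternion_pair /=.
case: (norm_solution s d) => a c /= <-; rewrite det_companion det_mx2; split=> //.
by ring.
Qed.

Lemma quaternion_pair_AC s d : s != 0 -> s + d != 0 -> quaternion_pair (s, d) \in AC.
Proof.
move=> s0 sd; have := norm_solutionP d s0; rewrite /quaternion_pair /=.
case: (norm_solution s d) => a c /= acd; rewrite inE /= /companion !expr2 !mx2E unit_mx2.
apply/andP; split; first by apply/eqP; congr mx2; ring.
apply: contra sd => /eqP e; rewrite -[_ == _](@expf_eq0 _ _ 2) -acd; apply/eqP.
by rewrite -[RHS]e; ring.
Qed.

(** Here S ^ 2 = - e, and the two matrices D belong to z = a + c S and z' = x + y S,
    of the same norm d. A conjugating matrix that commutes with S is an element
    u of F[S] with u z = z' u^, where ^ is the conjugation of F[S]. As z' / z has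
    norm 1, the recipe of Hilbert 90 provides such u: with z' z^ = m + k S, both
    d + z' z^ and S (d - z' z^) are solutions. Their norms are 2 d (d + m) and
    2 e d (d - m), and these cannot both vanish. *)
Lemma quaternion_pair_conj (e d a c x y : F) : e != 0 -> d != 0 ->
    a ^+ 2 + e * c ^+ 2 = d -> x ^+ 2 + e * y ^+ 2 = d ->
  conj_pair (companion 0 e, mx2 a (e * c) c (- a))
            (companion 0 e, mx2 x (e * y) y (- x)).
Proof.
move=> e0 d0 N1 N2; pose m := x * a + e * y * c; pose k := y * a - x * c.
(* The entries are compared modulo the two norm equations. *)
have comb (k1 k2 L R : F) :
    L - R = k1 * (a ^+ 2 + e * c ^+ 2 - d) + k2 * (x ^+ 2 + e * y ^+ 2 - d) -> L = R.
  by rewrite N1 N2 !subrr !mulr0 addr0 => /subr0_eq.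
have mk : m ^+ 2 + e * k ^+ 2 = d ^+ 2 by rewrite [RHS]expr2 -{1}N1 -N2 /m /k; ring.
have [dm | dm] := eqVneq (d + m) 0; last first.
  apply/conj_pairP; exists (mx2 (d + m) (- e * k) k (d + m)); split.
  - rewrite unit_mx2; apply: contraNneq dm => H.
    have : 2%:R * (d * (d + m)) = 0.
      transitivity (d ^+ 2 + 2%:R * d * m + d ^+ 2); first by ring.
      by rewrite -{2}mk -H; ring.
    by move/eqP; rewrite !mulf_eq0 (negPf two_neq0) (negPf d0).
  - by rewrite /= /companion !mx2M; congr mx2; ring.
  rewrite /= !mx2M; congr mx2.
  - by apply: (comb x (- a)); rewrite /m /k; ring.
  - by apply: (comb (e * y) (- (e * c))); rewrite /m /k; ring.
  - by apply: (comb y (- c)); rewrite /m /k; ring.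
  - by apply: (comb (- x) a); rewrite /m /k; ring.
apply/conj_pairP; exists (mx2 (e * k) (- e * (d - m)) (d - m) (e * k)); split.
- rewrite unit_mx2; apply/eqP => H.
  have : e * (2%:R * (d * (d - m))) = 0.
    transitivity (e * (d ^+ 2 - 2%:R * d * m + d ^+ 2)); first by ring.
    by rewrite -{2}mk -H; ring.
  have -> : d - m = 2%:R * d - (d + m) by ring.
  rewrite dm subr0.
  by move/eqP; rewrite !mulf_eq0 (negPf two_neq0) (negPf d0) (negPf e0).
- by rewrite /= /companion !mx2M; congr mx2; ring.
rewrite /= !mx2M; congr mx2.
- by apply: (comb (e * y) (e * c)); rewrite /m /k; ring.
- by apply: (comb (- (e * x)) (- (e * a))); rewrite /m /k; ring.
- by apply: (comb (- x) (- a)); rewrite /m /k; ring.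
- by apply: (comb (- (e * y)) (- (e * c))); rewrite /m /k; ring.
Qed.

Lemma quaternion_pair_form (x : M2 * M2) : x \in AC -> x.1 != 0 -> \tr x.1 = 0 ->
    \det x.1 != 0 -> \det x.2 != 0 ->
  exists s d, [/\ s != 0, d != 0, s + d != 0 & conj_pair (quaternion_pair (s, d)) x].
Proof.
move=> Ax S0 T0 s0 d0; have [a [c []]] := traceless_form two_neq0 Ax S0 T0.
set e := \det x.1 in s0 *; set d := a ^+ 2 + _ => _ cx sd.
have {}d0 : d != 0.
  apply: contraNneq d0 => d0; rewrite -(conj_pair_det2 cx) /= det_mx2 -oppr0 -d0 /d.
  by apply/eqP; ring.
exists (- e), d; rewrite oppr_eq0; split=> //; apply: conj_pair_trans cx.
have := norm_solutionP d (_ : - e != 0); rewrite oppr_eq0 => /(_ s0).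
rewrite /quaternion_pair /=; case: (norm_solution _ _) => a' c' /= E.
rewrite opprK; apply: (quaternion_pair_conj s0 d0) => //.
by rewrite -E; ring.
Qed.

End QuaternionPairs.

(** * Classes of anticommuting pairs *)

(** The families below are cut out of the anticommuting pairs by several
    conditions; one call detaches the last condition. *)
Ltac in_leaf := apply/setIdP; split=> //=.

Section CountPairs.

Variable F : finFieldType.
Hypothesis two_neq0 : 2%:R != 0 :> F.

Local Notation M2 := 'M[F]_2.
Local Notation AC := (anticommuting F).

Section Invariant.

Variable Q : pred (M2 * M2).
Hypothesis Qinv : forall x y, conj_pair x y -> Q x -> Q y.

(** The predicate Q will be either true or the singularity of 1 - S, so that the
    decomposition into families is made once for the two counts. *)
Definition Qclasses (P : {set M2 * M2}) : nat :=
  nclasses (@conj_pair F) [set x in P | Q x].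

Lemma Qclasses_split (R : pred (M2 * M2)) (P : {set M2 * M2}) :
    (forall x y, conj_pair x y -> R x -> R y) ->
  Qclasses P = (Qclasses [set x in P | R x] + Qclasses [set x in P | ~~ R x])%N.
Proof.
move=> Rinv; rewrite /Qclasses (nclasses_split (@conj_pair_equivalence F) (Q := R)).
  by congr (_ + _)%N; congr (nclasses (@conj_pair F) _); apply/setP=> x; rewrite !inE andbAC.
by move=> x y _ _ xy; apply/idP/idP; apply: Rinv => //; apply: conj_pair_sym.
Qed.

Lemma Qclasses_reps (I : finType) (P : {set M2 * M2}) (J : {set I}) rep :
    {in J, forall i, rep i \in P} ->
    {in J &, forall i j, conj_pair (rep i) (rep j) -> i = j} ->
    {in P, forall x, exists2 i, i \in J & conj_pair (rep i) x} ->
  Qclasses P = #|[set i in J | Q (rep i)]|.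
Proof. exact: nclasses_reps_inv (@conj_pair_equivalence F) Qinv. Qed.

Let inv0 x y : conj_pair x y -> x.2 == 0 :> M2 -> y.2 == 0 :> M2.
Proof. by rewrite -conj_swap => /conj_pair_inv0. Qed.

Let inv_scalar2 x y : conj_pair x y -> is_scalar_mx (x.2 : M2) -> is_scalar_mx (y.2 : M2).
Proof. by rewrite -conj_swap => /conj_pair_scalar. Qed.

(** The cases, in the order of the sum: D = 0, with S scalar or not; S = 0, with D
    scalar or not; then S and D both non-zero, with tr S != 0, or traceless with
    S nilpotent, with D nilpotent, or with both invertible. In the last case
    s + d is the scalar S ^ 2 + D ^ 2, which must be invertible. *)
Lemma Qclasses_anticommuting :
  Qclasses AC =
  (#|[set a : F in [set a | a != 0%R] | Q (a%:M, 0%R)]|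
   + #|[set td : F * F in [set td | td.2 != 0%R] | Q (companion td.1 td.2, 0%R)]|
   + (#|[set a : F in [set a | a != 0%R] | Q (0%R, a%:M)]|
      + #|[set td : F * F in [set td | td.2 != 0%R] | Q (0%R, companion td.1 td.2)]|
   + (#|[set sd : F * F in [set sd | (sd.1 != 0%R) && (sd.2 != 0%R)] |
          Q (mx2 sd.1 0 0 0, mx2 0 0 0 sd.2)]|
   + (#|[set t : F in [set t | t != 0%R] | Q (mx2 0 0 1 0, mx2 (- t) 0 0 t)]|
   + (#|[set t : F in [set t | t != 0%R] | Q (mx2 (- t) 0 0 t, mx2 0 0 1 0)]|
   + #|[set sd : F * F in [set sd | [&& sd.1 != 0, sd.2 != 0 & sd.1 + sd.2 != 0]%R] |
          Q (quaternion_pair sd)]|)))))%N.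
Proof.
rewrite (Qclasses_split (R := fun x => x.2 == 0)); last exact: inv0.
congr (_ + _)%N.
  rewrite (Qclasses_split (R := fun x => is_scalar_mx x.1)); last exact: conj_pair_scalar.
  congr (_ + _)%N.
    apply: (Qclasses_reps (rep := fun a : F => (a%:M, 0) : M2 * M2)).
    - move=> a; rewrite [in X in X -> _]inE => a0; in_leaf; first in_leaf.
        by apply: zero_in_AC; rewrite scalar_unit2.
      exact: scalar_mx_is_scalar.
    - by move=> a b _ _; apply: scalar_pair_inj.
    move=> x /setIdP[/setIdP[Ax x2] sx].
    by have [a a0 ax] := scalar_pair_form Ax x2 sx; exists a; rewrite ?inE.
  apply: (Qclasses_reps (rep := fun td : F * F => (companion td.1 td.2, 0) : M2 * M2)).
  - move=> td; rewrite [in X in X -> _]inE => d0; in_leaf; first in_leaf.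
      by apply: zero_in_AC; rewrite unit_companion.
    exact: companion_nscalar.
  - move=> [t d] [t' d'] _ _ cc; have := conj_pair_tr cc; have := conj_pair_det cc.
    by rewrite /= !tr_companion !det_companion => -> ->.
  move=> x /setIdP[/setIdP[Ax x2] sx].
  have [d0 cx] := nonscalar_pair_form Ax x2 sx.
  by exists (\tr x.1, \det x.1); rewrite ?inE.
rewrite (Qclasses_split (R := fun x => x.1 == 0)); last exact: conj_pair_inv0.
congr (_ + _)%N.
  rewrite (Qclasses_split (R := fun x => is_scalar_mx x.2)); last exact: inv_scalar2.
  congr (_ + _)%N.
    apply: (Qclasses_reps (rep := fun a : F => (0, a%:M) : M2 * M2)).
    - move=> a; rewrite [in X in X -> _]inE => a0; in_leaf; first in_leaf; first in_leaf.
      + by rewrite anticommuting_sym; apply: zero_in_AC; rewrite scalar_unit2.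
      + by rewrite mx2_scalar mx2_eq0 negb_and a0.
      exact: scalar_mx_is_scalar.
    - by move=> a b _ _; rewrite -conj_swap; apply: scalar_pair_inj.
    move=> x /setIdP[/setIdP[/setIdP[Ax _] x1] sx].
    have [|a a0 ax] := @scalar_pair_form F (x.2, x.1) _ x1 sx; first by rewrite -anticommuting_sym.
    by exists a; rewrite ?inE // -conj_swap.
  apply: (Qclasses_reps (rep := fun td : F * F => (0, companion td.1 td.2) : M2 * M2)).
  - move=> td; rewrite [in X in X -> _]inE => d0; in_leaf; first in_leaf; first in_leaf.
    + by rewrite anticommuting_sym; apply: zero_in_AC; rewrite unit_companion.
    + by rewrite mx2_eq0 oner_eq0 !andbF.
    exact: companion_nscalar.
  - move=> [t d] [t' d'] _ _ cc; have := conj_pair_tr2 cc; have := conj_pair_det2 cc.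
    by rewrite /= !tr_companion !det_companion => -> ->.
  move=> x /setIdP[/setIdP[/setIdP[Ax _] x1] sx].
  have [|d0 cx] := @nonscalar_pair_form F (x.2, x.1) _ x1 sx; first by rewrite -anticommuting_sym.
  by exists (\tr x.2, \det x.2); rewrite ?inE // -conj_swap.
rewrite (Qclasses_split (R := fun x => \tr x.1 != 0)); last first.
  by move=> x y /conj_pair_tr ->.
congr (_ + _)%N.
  apply: (Qclasses_reps (rep := fun sd : F * F => (mx2 sd.1 0 0 0, mx2 0 0 0 sd.2) : M2 * M2)).
  - move=> [s d]; rewrite [in X in X -> _]inE /= => /andP[s0 d0]; in_leaf; first in_leaf; first in_leaf.
    + exact: trace_pair_AC.
    + by rewrite mx2_eq0 (negPf d0) !andbF.
    + by rewrite mx2_eq0 (negPf s0).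
    by rewrite mxtrace_mx2 addr0.
  - move=> [s d] [s' d'] _ _ cc; have := conj_pair_tr2 cc; have := conj_pair_tr cc.
    by rewrite /= !mxtrace_mx2 !addr0 !add0r => -> ->.
  move=> x /setIdP[/setIdP[/setIdP[Ax x2] x1] T0].
  have [s [d [s0 d0 cx]]] := trace_pair_form two_neq0 Ax x2 T0.
  by exists (s, d); rewrite ?inE ?s0.
rewrite (Qclasses_split (R := fun x => \det x.1 == 0)); last first.
  by move=> x y /conj_pair_det ->.
congr (_ + _)%N.
  apply: (Qclasses_reps (rep := fun t : F => (mx2 0 0 1 0, mx2 (- t) 0 0 t) : M2 * M2)).
  - move=> t; rewrite [in X in X -> _]inE => t0; in_leaf; first in_leaf; first in_leaf; first in_leaf.
    + exact: nilpotent_pair_AC.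
    + by rewrite mx2_eq0 (negPf t0) !andbF.
    + by rewrite mx2_eq0 oner_eq0 !andbF.
    + by rewrite mxtrace_mx2 addr0 eqxx.
    by rewrite det_mx2 !mul0r subr0.
  - by move=> t t' _ _; apply: nilpotent_pair_inj.
  move=> x /setIdP[/setIdP[/setIdP[/setIdP[Ax x2] x1] /negPn/eqP T0] /eqP d0].
  by have [t t0 cx] := nilpotent_pair_form two_neq0 Ax x1 T0 d0; exists t; rewrite ?inE.
rewrite (Qclasses_split (R := fun x => \det x.2 == 0)); last first.
  by move=> x y /conj_pair_det2 ->.
congr (_ + _)%N.
  apply: (Qclasses_reps (rep := fun t : F => (mx2 (- t) 0 0 t, mx2 0 0 1 0) : M2 * M2)).
  - move=> t; rewrite [in X in X -> _]inE => t0; in_leaf; first in_leaf; first in_leaf; first in_leaf; first in_leaf.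
    + by rewrite anticommuting_sym; apply: nilpotent_pair_AC.
    + by rewrite mx2_eq0 oner_eq0 !andbF.
    + by rewrite mx2_eq0 (negPf t0) !andbF.
    + by rewrite mxtrace_mx2 addNr eqxx.
    + by rewrite det_mx2 mul0r subr0 mulf_neq0 ?oppr_eq0.
    by rewrite det_mx2 !mul0r subr0.
  - by move=> t t' _ _; rewrite -conj_swap; apply: nilpotent_pair_inj.
  move=> x /setIdP[/setIdP[/setIdP[/setIdP[/setIdP[Ax x2] x1] /negPn/eqP T0] _] /eqP d0].
  have T2 := traceless_tr2 two_neq0 Ax x1 T0.
  have [|t t0 cx] := @nilpotent_pair_form F two_neq0 (x.2, x.1) _ x2 T2 d0.
    by rewrite -anticommuting_sym.
  by exists t; rewrite ?inE // -conj_swap.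
apply: (Qclasses_reps (rep := @quaternion_pair F)).
- move=> [s d]; rewrite [in X in X -> _]inE /= => /and3P[s0 d0 sd0].
  have [ds dd] := det_quaternion_pair d s0.
  have nz (A : M2) (e : F) : \det A = - e -> e != 0 -> A != 0.
    by move=> AE; apply: contraNneq => A0; rewrite -oppr_eq0 -AE A0 det0.
  in_leaf; first in_leaf; first in_leaf; first in_leaf; first in_leaf.
  + exact: quaternion_pair_AC.
  + exact: nz dd d0.
  + exact: nz ds s0.
  + rewrite /quaternion_pair; case: (norm_solution _ _) => a c /=.
    by rewrite tr_companion eqxx.
  + by rewrite ds oppr_eq0.
  by rewrite dd oppr_eq0.
- move=> [s d] [s' d']; rewrite !inE => /andP[/= s0 _] /andP[/= s0' _] cc.
  have [ds dd] := det_quaternion_pair d s0.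
  have [ds' dd'] := det_quaternion_pair d' s0'.
  have := conj_pair_det cc; have := conj_pair_det2 cc; rewrite ds dd ds' dd'.
  by move=> /oppr_inj -> /oppr_inj ->.
move=> x /setIdP[/setIdP[/setIdP[/setIdP[/setIdP[Ax x2] x1] /negPn/eqP T0] s0] d0].
have [s [d [s0' d0' sd cx]]] := quaternion_pair_form two_neq0 Ax x1 T0 s0 d0.
by exists (s, d); rewrite ?inE ?s0' ?d0'.
Qed.

End Invariant.
End CountPairs.

(** * Counting over a plane of odd characteristic *)

Section PlaneOdd.

Variable F : finFieldType.
Hypothesis F_prime : forall x : F, exists n : nat, x = n%:R.
Hypothesis two_neq0 : 2%:R != 0 :> F.

Local Notation M2 := 'M[F]_2.

Lemma card_nz : #|[set a : F | a != 0]| = #|F|.-1.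
Proof. by rewrite -(cardsC1 (0 : F)); apply: eq_card => a; rewrite !inE. Qed.

Lemma card_nz_snd : #|[set td : F * F | td.2 != 0]| = (#|F| * #|F|.-1)%N.
Proof.
by rewrite -card_nz -cardsT -cardsX; apply: eq_card => -[t d]; rewrite !inE.
Qed.

Lemma card_nz_pair :
  #|[set sd : F * F | (sd.1 != 0) && (sd.2 != 0)]| = (#|F|.-1 * #|F|.-1)%N.
Proof. by rewrite -card_nz -cardsX; apply: eq_card => -[t d]; rewrite !inE. Qed.

Lemma card_nz_pair_sum :
  #|[set sd : F * F | [&& sd.1 != 0, sd.2 != 0 & sd.1 + sd.2 != 0]]|
  = (#|F|.-1 * #|F|.-1 - #|F|.-1)%N.
Proof.
rewrite -card_nz_pair -[in RHS](cardsID [set sd | sd.1 + sd.2 == 0]).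
rewrite [X in (X + _ - _)%N](_ : _ = #|F|.-1); last first.
  rewrite -card_nz -[RHS](card_imset (f := fun s : F => (s, - s))); last by move=> s t [].
  apply: eq_card => -[s d]; rewrite !inE /=; apply/andP/imsetP => [[/andP[s0 _]] | [t]].
    by rewrite addr_eq0 => /eqP sd; exists s; rewrite ?inE // sd opprK.
  by rewrite inE => t0 [-> ->]; rewrite oppr_eq0 t0 subrr eqxx.
by rewrite addKn; apply: eq_card => -[s d]; rewrite !inE /= [RHS]andbC andbA.
Qed.

Definition fixed_point_free (A : M2) : bool := 1 - A \is a GRing.unit.

Lemma fixed_point_free_mx2 a b c d :
  fixed_point_free (mx2 a b c d) = ((1 - a) * (1 - d) - b * c != 0).
Proof. by rewrite /fixed_point_free !mx2E unit_mx2 !add0r mulrNN. Qed.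

Lemma fixed_point_free_scalar a : fixed_point_free a%:M = (a != 1).
Proof.
by rewrite mx2_scalar fixed_point_free_mx2 mulr0 subr0 mulf_eq0 orbb subr_eq0 eq_sym.
Qed.

Lemma fixed_point_free_companion t d :
  fixed_point_free (companion t d) = (t != 1 + d).
Proof.
have E : (1 - 0) * (1 - t) - - d * 1 = (1 + d) - t by ring.
by rewrite fixed_point_free_mx2 E subr_eq0 eq_sym.
Qed.

Lemma fixed_point_free0 : fixed_point_free 0.
Proof. by rewrite /fixed_point_free subr0 unitr1. Qed.

Lemma singular_conj (x y : M2 * M2) : conj_pair x y ->
  ~~ fixed_point_free x.1 -> ~~ fixed_point_free y.1.
Proof.
case/conj_pairP=> u [Uu u1 _]; apply: contra; rewrite /fixed_point_free => Uy.
rewrite -(unitrMr _ Uu); have -> : u * (1 - x.1) = (1 - y.1) * u.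
  by rewrite mulrBr mulrBl u1 mulr1 mul1r.
by rewrite unitrMl.
Qed.

Lemma singular_sum_conj (x y : M2 * M2) : conj_pair x y ->
  ~~ fixed_point_free (x.1 + x.2) -> ~~ fixed_point_free (y.1 + y.2).
Proof.
case/conj_pairP=> u [Uu u1 u2].
apply: (@singular_conj (x.1 + x.2, 0) (y.1 + y.2, 0)); apply/conj_pairP; exists u.
by rewrite /= mulrDr mulrDl u1 u2 mulr0 mul0r.
Qed.

Lemma singular_pairsE : singular_pairs F
  = [set x in paramedial_pairs F | ~~ fixed_point_free (x.1 + x.2)].
Proof.
by apply/setP=> x; rewrite ![x \in [set _ in _ | _]]inE /fixed_point_free opprD addrA.
Qed.

Lemma nclasses_pairs_odd :
  nclasses (@conj_pair F) (paramedial_pairs F) = (4 * #|F| ^ 2 - 3 * #|F| - 1)%N.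
Proof.
have -> : paramedial_pairs F = [set x in paramedial_pairs F | xpredT (x.1 + x.2)].
  by apply/setP=> x; rewrite [RHS]inE andbT.
rewrite (nclasses_anticommuting two_neq0 xpredT).
have := @Qclasses_anticommuting F two_neq0 xpredT (fun _ _ _ _ => isT).
rewrite /Qclasses => ->.
have setT_id (T : finType) (A : {set T}) : [set x in A | true] = A.
  by apply/setP=> x; rewrite inE andbT.
rewrite !setT_id card_nz card_nz_snd card_nz_pair card_nz_pair_sum.
have : (1 < #|F|)%N by apply: card_finNzRing_gt1.
by case: #|F| => [|[|m]] // _; rewrite /= !expnS expn0; nia.
Qed.

(** In each family 1 - S is singular when 1 is an eigenvalue of S, which fixes one
    parameter of the normal form. It never happens if S is 0 or nilpotent. *)
Lemma nclasses_singular_odd :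
  nclasses (@conj_pair F) (singular_pairs F) = (3 * #|F| - 1)%N.
Proof.
rewrite singular_pairsE.
rewrite (nclasses_anticommuting two_neq0 (fun A => ~~ fixed_point_free A)).
have := @Qclasses_anticommuting F two_neq0 (fun x => ~~ fixed_point_free x.1) singular_conj.
rewrite /Qclasses => ->.
rewrite [X in (X + _ + _)%N](_ : _ = 1%N); last first.
  transitivity #|[set 1 : F]|; last exact: cards1.
  apply: eq_card => a; rewrite !inE /= fixed_point_free_scalar negbK.
  by case: (eqVneq a 1) => [->|]; rewrite ?andbF // oner_eq0.
rewrite [X in (_ + X + _)%N](_ : _ = #|F|.-1); last first.
  rewrite -card_nz -[RHS](card_imset (f := fun d : F => (1 + d, d))); last by move=> d e [].
  apply: eq_card => -[t d]; rewrite !inE /= fixed_point_free_companion negbK.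
  apply/andP/imsetP => [[d0 /eqP ->] | [e]]; first by exists d; rewrite ?inE.
  by rewrite inE => e0 [-> ->].
rewrite [X in (_ + (X + _ + _))%N](_ : _ = 0%N); last first.
  by apply: eq_card0 => a; rewrite !inE /= fixed_point_free0 andbF.
rewrite [X in (_ + (_ + X + _))%N](_ : _ = 0%N); last first.
  by apply: eq_card0 => a; rewrite !inE /= fixed_point_free0 andbF.
rewrite [X in (_ + (_ + (X + _)))%N](_ : _ = #|F|.-1); last first.
  rewrite -card_nz -[RHS](card_imset (f := fun d : F => (1 : F, d))); last by move=> d e [].
  apply: eq_card => -[s d]; rewrite !inE /= fixed_point_free_mx2 negbK.
  rewrite subr0 mulr1 mulr0 subr0 subr_eq0.
  apply/andP/imsetP => [[/andP[_ d0] /eqP <-] | [e]]; first by exists d; rewrite ?inE.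
  by rewrite inE => e0 [-> ->]; rewrite oner_eq0 e0.
rewrite [X in (_ + (_ + (_ + (X + _))))%N](_ : _ = 0%N); last first.
  apply: eq_card0 => t; rewrite !inE /= fixed_point_free_mx2.
  by rewrite subr0 mulr1 mul0r subr0 oner_eq0 andbF.
rewrite [X in (_ + (_ + (_ + (_ + (X + _)))))%N](_ : _ = 2%N); last first.
  have n1 : 1 != -1 :> F by rewrite -addr_eq0.
  transitivity #|[set 1; -1 : F]|; last by rewrite cards2 n1.
  apply: eq_card => t; rewrite !inE /= fixed_point_free_mx2 negbK mul0r subr0 opprK.
  rewrite mulf_eq0 subr_eq0 [1 + t]addrC addr_eq0 [1 == t]eq_sym orbC.
  case: (eqVneq t 1) => [-> | _] /=; first by rewrite oner_eq0.
  by case: (eqVneq t (-1)) => [-> | _]; rewrite ?oppr_eq0 ?oner_eq0 ?andbF.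
rewrite [X in (_ + (_ + (_ + (_ + (_ + X)))))%N](_ : _ = #|F|.-2); last first.
  transitivity #|~: [set 0; -1 : F]|; last first.
    have n1 : 0 != -1 :> F by rewrite eq_sym oppr_eq0 oner_eq0.
    by have := cardsC [set 0; -1 : F]; rewrite cards2 n1 => <-.
  rewrite -[RHS](card_imset (f := fun d : F => (1 : F, d))); last by move=> d e [].
  apply: eq_card => -[s d]; rewrite !inE /=.
  have -> : (quaternion_pair (s, d)).1 = companion 0 (- s).
    by rewrite /quaternion_pair; case: (norm_solution _ _).
  rewrite fixed_point_free_companion negbK [0 == _]eq_sym subr_eq0.
  apply/andP/imsetP => [[/and3P[_ d0 sd] /eqP s1] | [e]].
    exists d; rewrite ?inE ?negb_or ?d0 -?s1 //=.
    by apply: contra sd => /eqP ->; rewrite -s1 subrr.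
  rewrite !inE negb_or => /andP[e0 e1] [-> ->]; rewrite oner_eq0 e0 eqxx /= addrC.
  by rewrite addr_eq0.
have : (1 < #|F|)%N by apply: card_finNzRing_gt1.
by case: #|F| => [|[|m]] // _; rewrite /=; lia.
Qed.

Theorem pq_plane_odd : pq (F * F)%type = (4 * #|F| ^ 2 - 2)%N.
Proof.
rewrite (pq_plane F_prime) nclasses_pairs_odd nclasses_singular_odd.
have : (1 < #|F|)%N by apply: card_finNzRing_gt1.
by rewrite expnS expn1; nia.
Qed.

End PlaneOdd.

(** * The plane over the field with two elements *)

Section PlaneTwo.

Local Notation F := 'F_2.
Local Notation M2 := 'M[F]_2.

Lemma F2P (x : F) : x = 0 \/ x = 1.
Proof. by case: x => [[|[|//]] ?]; [left | right]; apply: val_inj. Qed.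

Lemma F2_neq0 (x : F) : x != 0 -> x = 1.
Proof. by case: (F2P x) => ->. Qed.

Let swap : M2 := mx2 0 1 1 0.
Let shear : M2 := mx2 1 1 0 1.
Let order3 : M2 := mx2 0 1 1 1.

Definition pair_reps_F2 : seq (M2 * M2) :=
  [:: (1, 1); (1, swap); (swap, 1); (swap, swap); (swap, shear); (order3, order3)].

Definition pair_rep_F2 (i : 'I_6) : M2 * M2 := nth (1, 1) pair_reps_F2 i.

(** The determinant is 1, so a non-scalar matrix is determined up to conjugacy by
    its trace, which takes two values. *)
Lemma unit_F2 (A : M2) : A \is a GRing.unit ->
  A = 1 \/ exists2 C, C \in [:: swap; order3]
           & exists2 u, u \is a GRing.unit & u * C = A * u.
Proof.
move=> UA; have [/is_scalar_mxP[a Aa] | nS] := boolP (is_scalar_mx A).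
  by left; move: UA; rewrite Aa scalar_unit2 => /F2_neq0 ->.
right; have [u Uu uA] := companion_conj nS; move: uA.
move: UA; rewrite -[_ \is a _]/(A \in unitmx) unitmxE unitfE => /F2_neq0 ->.
have m1 : - 1 = 1 :> F by apply: val_inj.
rewrite /companion m1; case: (F2P (\tr A)) => -> uA.
  by exists swap; rewrite ?inE ?eqxx //; exists u.
by exists order3; rewrite ?inE ?eqxx ?orbT //; exists u.
Qed.

Lemma swap_partner (B : M2) : swap ^+ 2 = B ^+ 2 ->
  B \in [:: 1; swap; shear; mx2 1 0 1 1].
Proof.
have [x [y [z [w ->]]]] := mx2P B; rewrite /swap /shear !expr2 !mx2E.
case: (F2P x) => ->; case: (F2P y) => ->; case: (F2P z) => ->; case: (F2P w) => ->;
  move=> /mx2_inj[/eqP + /eqP + /eqP + /eqP]; rewrite ?inE ?eqxx ?orbT //.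
Qed.

Lemma order3_partner (B : M2) : order3 ^+ 2 = B ^+ 2 -> B = order3.
Proof.
have [x [y [z [w ->]]]] := mx2P B; rewrite /order3 !expr2 !mx2E.
case: (F2P x) => ->; case: (F2P y) => ->; case: (F2P z) => ->; case: (F2P w) => ->;
  by move=> /mx2_inj[/eqP + /eqP + /eqP + /eqP].
Qed.

Lemma order3_sqr_neq1 : order3 ^+ 2 != 1.
Proof. by rewrite /order3 expr2 !mx2E; apply/eqP=> /mx2_inj[/eqP]. Qed.

Lemma mx2_eqE (a b c d a' b' c' d' : F) : (mx2 a b c d == mx2 a' b' c' d') =
  [&& a == a', b == b', c == c' & d == d'].
Proof.
apply/eqP/and4P => [/mx2_inj[-> -> -> ->] // | [/eqP-> /eqP-> /eqP-> /eqP->] //].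
Qed.

Definition pair_invariant_F2 (x : M2 * M2) : bool * bool * bool * F :=
  (x.1 == 1, x.2 == 1, x.1 == x.2, \tr x.1).

Lemma pair_invariant_conj x y : conj_pair x y ->
  pair_invariant_F2 x = pair_invariant_F2 y.
Proof.
move=> xy; have xytr := conj_pair_tr xy; case/conj_pairP: xy => u [Uu u1 u2].
have E A B A' B' : u * A = A' * u -> u * B = B' * u -> (A == B) = (A' == B') :> bool.
  by move=> a b; rewrite -(inj_eq (mulrI Uu)) a b (inj_eq (mulIr Uu)).
have u11 : u * 1 = 1 * u by rewrite mulr1 mul1r.
by rewrite /pair_invariant_F2 xytr (E _ _ _ _ u1 u11) (E _ _ _ _ u2 u11) (E _ _ _ _ u1 u2).
Qed.

Lemma pair_rep_F2_inj i j : conj_pair (pair_rep_F2 i) (pair_rep_F2 j) -> i = j.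
Proof.
have inv_uniq : uniq (map pair_invariant_F2 pair_reps_F2).
  rewrite /= /pair_invariant_F2 /= /swap /shear /order3 !mx2_1 !mxtrace_mx2 !mx2_eqE.
  by vm_compute.
move/pair_invariant_conj; rewrite /pair_rep_F2.
rewrite -!(nth_map _ (pair_invariant_F2 (1, 1))) ?ltn_ord // => /eqP.
by rewrite nth_uniq ?size_map ?ltn_ord // => /eqP /val_inj.
Qed.

Lemma pair_rep_F2_paramedial i : pair_rep_F2 i \in paramedial_pairs F.
Proof.
suff : all (mem (paramedial_pairs F)) pair_reps_F2.
  by move/allP; apply; apply: mem_nth; apply: ltn_ord.
by rewrite /= !inE /= /swap /shear /order3 !expr2 !mx2E !unit_mx2 !mx2_eqE; vm_compute.
Qed.

Lemma pair_rep_F2_complete x : x \in paramedial_pairs F ->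
  exists i, conj_pair (pair_rep_F2 i) x.
Proof.
case: x => A B; rewrite inE /= => /and3P[UA UB /eqP AB].
have [A1 | [C Cs [u Uu uC]]] := unit_F2 UA.
  have [B1 | [C Cs [u Uu uC]]] := unit_F2 UB.
    by exists (@Ordinal 6 0 isT); rewrite A1 B1 conj_pair_refl.
  move: Cs uC; rewrite !inE => /orP[] /eqP-> uC.
    exists (@Ordinal 6 1 isT); apply/conj_pairP; exists u.
    by rewrite /= A1 mulr1 mul1r.
  case/eqP: order3_sqr_neq1; apply: (mulrI Uu).
  by rewrite expr2 mulrA uC -mulrA uC mulrA -expr2 -AB A1 expr1n mul1r mulr1.
pose B' := u^-1 * B * u.
have cx : conj_pair (C, B') (A, B).
  by apply/conj_pairP; exists u; rewrite /= !mulrA mulrV // mul1r.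
have CB : C ^+ 2 = B' ^+ 2.
  apply: (mulrI Uu); rewrite [B' ^+ 2]expr2 /B' !mulrA mulrV // mul1r mulrK //.
  by rewrite -[B * B]expr2 -AB !expr2 uC -!mulrA uC.
move: Cs cx CB; rewrite !inE => /orP[] /eqP-> cx CB; last first.
  exists (@Ordinal 6 5 isT); apply: conj_pair_trans cx.
  by rewrite (order3_partner CB) conj_pair_refl.
have := swap_partner CB; rewrite !inE => /or4P[] /eqP BE; rewrite BE in cx.
- by exists (@Ordinal 6 2 isT).
- by exists (@Ordinal 6 3 isT).
- by exists (@Ordinal 6 4 isT).
(* The two transvections are exchanged by swap. *)
exists (@Ordinal 6 4 isT); apply: conj_pair_trans cx; apply/conj_pairP; exists swap.
by rewrite /= /swap /shear !mx2M unit_mx2; split=> //; congr mx2; apply: val_inj.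
Qed.

Lemma nclasses_pairs_two : nclasses (@conj_pair F) (paramedial_pairs F) = 6%N.
Proof.
transitivity #|[set: 'I_6]|; last by rewrite cardsT card_ord.
apply: (@nclasses_reps _ _ _ _ _ pair_rep_F2).
- exact: conj_pair_equivalence.
- by move=> i _; apply: pair_rep_F2_paramedial.
- by move=> i j _ _; apply: pair_rep_F2_inj.
by move=> x /pair_rep_F2_complete[i ix]; exists i; rewrite ?in_setT.
Qed.

(** Only for the pair (swap, shear) is 1 - A - B singular. *)
Lemma nclasses_singular_two : nclasses (@conj_pair F) (singular_pairs F) = 1%N.
Proof.
pose Q (x : M2 * M2) := ~~ fixed_point_free (x.1 + x.2).
rewrite singular_pairsE.
transitivity #|[set i in [set: 'I_6] | Q (pair_rep_F2 i)]|.
  apply: (@nclasses_reps_inv _ _ _ _ _ pair_rep_F2 Q).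
  - exact: conj_pair_equivalence.
  - exact: singular_sum_conj.
  - by move=> i _; apply: pair_rep_F2_paramedial.
  - by move=> i j _ _; apply: pair_rep_F2_inj.
  by move=> x /pair_rep_F2_complete[i ix]; exists i; rewrite ?in_setT.
transitivity #|[set @Ordinal 6 4 isT]|; last exact: cards1.
apply: eq_card => i; rewrite in_set1 in_set in_setT /=.
apply/idP/idP; case: i => [[|[|[|[|[|[|//]]]]]] ?];
  by rewrite /Q /pair_rep_F2 /= /swap /shear /order3 !mx2E fixed_point_free_mx2; vm_compute.
Qed.

End PlaneTwo.

(** * Prime fields, and the theorem *)

Lemma Fp_prime_field p (x : 'F_p) : exists n : nat, x = n%:R.
Proof. by exists x; rewrite natr_Zp. Qed.

Theorem pq_plane_two : pq ('F_2 * 'F_2)%type = 7.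
Proof.
rewrite (pq_plane (@Fp_prime_field 2)).
by rewrite nclasses_pairs_two nclasses_singular_two.
Qed.

Theorem pq_plane_odd_prime p : prime p -> odd p ->
  pq ('Z_p * 'Z_p)%type = (4 * p ^ 2 - 2)%N.
Proof.
move=> p_pr p_odd.
have two_neq0 : 2%:R != 0 :> 'F_p.
  rewrite -[_ == _]/(_) -(dvdn_pcharf (pchar_Fp p_pr)) dvdn_prime2 //.
  by apply: contraTneq p_odd => ->.
have : pq ('F_p * 'F_p)%type = (4 * #|'F_p| ^ 2 - 2)%N.
  exact: (pq_plane_odd (@Fp_prime_field p) two_neq0).
by rewrite card_Fp // pdiv_id.
Qed.

Local Close Scope ring_scope.

Theorem theorem1p1 :
  (forall p k : nat, prime p -> odd p -> 1 <= k ->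
     pq 'Z_(p ^ k) =
       2 * p ^ k - p ^ (k - 1) + \sum_(0 <= i < k - 1) p ^ i) /\
  (forall p : nat, prime p -> odd p ->
     pq ('Z_p * 'Z_p)%type = 4 * p ^ 2 - 2) /\
  (forall k : nat, 2 < k -> pq 'Z_(2 ^ k) = 2 ^ (k + 1)) /\
  pq 'Z_4 = 4 /\
  pq 'Z_2 = 1 /\
  pq ('Z_2 * 'Z_2)%type = 7.
Proof.
split; first exact: pq_cyclic_odd.
split; first exact: pq_plane_odd_prime.
split; first exact: pq_cyclic_two_large.
split; first exact: pq_Z4.
split; first exact: pq_Z2.
exact: pq_plane_two.
Qed.
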